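(* Let $\alpha\in\mathbb{R}$. For $0<h\le 1$ let $\Delta_h$ be the Laplace-Beltrami operator of the metric $g_h$ on the two-dimensional torus $\mathbb{T}^2=\mathbb{R}^2/\mathbb{Z}^2$, i.e. \[ \Delta_h=-\frac{1}{1+\alpha^2}\left(\frac{\partial}{\partial x}+\alpha\frac{\partial}{\partial y}\right)^2-\frac{h^{2}}{1+\alpha^2}\left(-\alpha\frac{\partial}{\partial x}+\frac{\partial}{\partial y}\right)^2, \] and let $N_h(\lambda)$ be its spectrum (eigenvalue) distribution function, i.e. the number of eigenvalues of $\Delta_h$ not exceeding $\lambda$, counted with multiplicity. Then, for a fixed $\lambda\in\mathbb{R}$, the following asymptotic formulas hold. 1. For $\alpha\notin\mathbb{Q}$, \[ N_h(\lambda)=\frac{1}{4\pi}h^{-1}\lambda+o(h^{-1}),\qquad h\rightarrow 0 . \] 2. For $\alpha\in\mathbb{Q}$ of the form $\alpha=\frac{p}{q}$, where $p,q\in\mathbb{Z}$, $q\neq 0$, $\gcd(p,q)=1$, \[ N_h(\lambda)=h^{-1}\sum_{k\in\mathbb{Z}:\ \frac{4\pi^2}{p^2+q^2}k^2<\lambda}\frac{1}{\pi\sqrt{p^2+q^2}}\left(\lambda-\frac{4\pi^2}{p^2+q^2}k^2\right)^{1/2}+o(h^{-1}),\qquad h\rightarrow 0 \] (an empty sum being $0$).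
   Context: The torus $\mathbb{T}^2=\mathbb{R}^2/\mathbb{Z}^2$ has coordinates $(x,y)\in\mathbb{R}^2$ taken modulo integer translations, and carries the Euclidean metric $g=dx^2+dy^2$. For $\alpha\in\mathbb{R}$, let $\mathcal{F}$ be the foliation of $\mathbb{T}^2$ by the orbits of the vector field induced by $\frac{\partial}{\partial x}+\alpha\frac{\partial}{\partial y}$. Let $F=T\mathcal{F}$ be the line subbundle of $T\mathbb{T}^2$ spanned by $(1,\alpha)$, and $H=F^{\perp}$ its $g$-orthogonal complement, spanned by $(-\alpha,1)$. The decomposition $T\mathbb{T}^2=F\oplus H$ induces a decomposition $g=g_F+g_H$ of the metric, and one sets $g_h=g_F+h^{-2}g_H$ for $0<h\le 1$. For a Riemannian metric with matrix $(g_{ij})$, determinant $g$ and inverse matrix $(g^{ij})$, the Laplace-Beltrami operator is $\Delta=-\frac{1}{\sqrt{g}}\sum_{i,j}\frac{\partial}{\partial x^i}\left(g^{ij}\sqrt{g}\frac{\partial}{\partial x^j}\right)$ (so it is nonnegative). The operator $\Delta_h$ is this operator for the metric $g_h$, acting on functions on $\mathbb{T}^2$, considered as a self-adjoint operator in the space $L^2(\mathbb{T}^2,g_h)$ of functions square-integrable with respect to the Riemannian volume of $g_h$. Its spectrum is discrete, $\operatorname{spec}\Delta_h=\{\lambda_i(h): i=0,1,\dots\}$ with multiplicities taken into account, and the eigenvalue (spectrum) distribution function is $N_h(\lambda)=\#\{i:\lambda_i(h)\le\lambda\}$.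
   Formalization: In part 1 (α irrational) the formula is stated only for λ ≥ 0: for λ < 0 it fails, since Δ_h is nonnegative and N_h(λ) = 0, while λ/(4πh) is a nonzero multiple of h^{-1}. *)

(* Defs.v *)
From HB Require Import structures.
From mathcomp Require Import all_boot all_order all_algebra.
From mathcomp Require Import all_classical all_reals all_analysis.

Set Implicit Arguments.
Unset Strict Implicit.
Unset Printing Implicit Defensive.

Import Order.TTheory GRing.Theory Num.Theory.
Import numFieldNormedType.Exports.

Local Open Scope classical_set_scope.
Local Open Scope ring_scope.

(* MathComp-Analysis.  Functions on T^2 = R^2 / Z^2 are represented
   by Z^2-periodic real-valued functions on R^2 = R * R, and tangent vectors
   of T^2 by elements of R * R. *)

Definition torus_fun (R : realType) (u : R * R -> R) : Prop :=
  forall x y : R, u (x + 1, y) = u (x, y) /\ u (x, y + 1) = u (x, y).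

Definition ebase (R : realType) (i : 'I_2) : R * R :=
  if i == 0 then (1, 0) else (0, 1).

Definition partial (R : realType) (i : 'I_2) (u : R * R -> R) : R * R -> R :=
  fun p => 'D_(ebase R i) u p.

Definition iter_partial (R : realType) (s : seq 'I_2) (u : R * R -> R) :
    R * R -> R :=
  foldr (@partial R) u s.

(* u is C^oo on T^2: all iterated partial derivatives exist and are
   continuous. *)
Definition smooth_torus (R : realType) (u : R * R -> R) : Prop :=
  torus_fun u /\
  forall s : seq 'I_2,
    continuous (iter_partial s u) /\
    forall (i : 'I_2) (p : R * R), derivable (iter_partial s u) p (ebase R i).

(* The field of matrices (g_ij) of a Riemannian metric in the coordinates
   (x, y). *)
Definition metric (R : realType) := R * R -> 'M[R]_2.

Definition vol_density (R : realType) (G : metric R) (p : R * R) : R :=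
  Num.sqrt (\det (G p)).

Definition laplace_beltrami (R : realType) (G : metric R) (u : R * R -> R) :
    R * R -> R :=
  fun p => - ((vol_density G p)^-1 *
    \sum_(i < 2) \sum_(j < 2)
      partial i
        (fun r => invmx (G r) i j * vol_density G r * partial j u r) p).

Definition euclid (R : realType) (v w : R * R) : R := v.1 * w.1 + v.2 * w.2.

(* Euclidean orthogonal projection of v onto the line spanned by f. *)
Definition line_proj (R : realType) (f v : R * R) : R * R :=
  let c := euclid v f / euclid f f in (c * f.1, c * f.2).

Definition Fdir (R : realType) (alpha : R) : R * R := (1, alpha).
Definition Hdir (R : realType) (alpha : R) : R * R := (- alpha, 1).

Definition g_F (R : realType) (alpha : R) (v w : R * R) : R :=
  euclid (line_proj (Fdir alpha) v) (line_proj (Fdir alpha) w).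

Definition g_H (R : realType) (alpha : R) (v w : R * R) : R :=
  euclid (line_proj (Hdir alpha) v) (line_proj (Hdir alpha) w).

Definition g_ (R : realType) (alpha h : R) : metric R :=
  fun _ => \matrix_(i < 2, j < 2)
    (g_F alpha (ebase R i) (ebase R j) +
     h ^- 2 * g_H alpha (ebase R i) (ebase R j)).

(* The first-order operator v.1 d/dx + v.2 d/dy. *)
Definition vfield (R : realType) (v : R * R) (u : R * R -> R) : R * R -> R :=
  fun p => v.1 * partial 0 u p + v.2 * partial 1 u p.

Definition leb2 (R : realType) := (@lebesgue_measure R \x @lebesgue_measure R)%E.

(* A fundamental domain of Z^2. *)
Definition unit_square (R : realType) : set (R * R) :=
  `[0, 1[%classic `*` `[0, 1[%classic.

(* The square of the norm of u in L^2(T^2, G). *)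
Definition L2sq (R : realType) (G : metric R) (u : R * R -> R) : \bar R :=
  (\int[@leb2 R]_(p in @unit_square R) (u p ^+ 2 * vol_density G p)%:E)%E.

Definition L2_torus (R : realType) (G : metric R) (u : R * R -> R) : Prop :=
  [/\ torus_fun u, measurable_fun [set: measurableTypeR R * measurableTypeR R] u & (L2sq G u < +oo)%E].

(* Functions equal almost everywhere represent the same element of L^2. *)
Definition ae_zero (R : realType) (u : R * R -> R) : Prop :=
  {ae @leb2 R, forall p, u p = 0}.

(* The graph, in L^2(T^2, G), of the self-adjoint Laplace-Beltrami operator:
   the closure of the differential operator with domain C^oo(T^2), which is
   essentially self-adjoint because T^2 is closed. *)
Definition laplacian_graph (R : realType) (G : metric R)
    (u v : R * R -> R) : Prop :=
  [/\ L2_torus G u, L2_torus G v &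
    exists phi : nat -> R * R -> R,
      [/\ forall n, smooth_torus (phi n),
          (fun n => L2sq G (phi n \- u)) @ \oo --> 0%E &
          (fun n => L2sq G (laplace_beltrami G (phi n) \- v)) @ \oo --> 0%E]].

Definition eigenfunction (R : realType) (G : metric R) (mu : R)
    (u : R * R -> R) : Prop :=
  laplacian_graph G u (fun p => mu * u p).

Definition laplace_eigenvalue (R : realType) (G : metric R) (mu : R) : Prop :=
  exists u : R * R -> R, eigenfunction G mu u /\ ~ ae_zero u.

Definition L2_free (R : realType) (n : nat) (u : 'I_n -> R * R -> R) : Prop :=
  forall c : 'I_n -> R,
    ae_zero (fun p => \sum_(i < n) c i * u i p) -> forall i, c i = 0.

(* The dimension (possibly +oo) of the eigenspace of mu. *)
Definition multiplicity (R : realType) (G : metric R) (mu : R) : \bar R :=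
  ereal_sup [set n%:R%:E | n in [set n : nat |
    exists u : 'I_n -> R * R -> R,
      (forall i, eigenfunction G mu (u i)) /\ L2_free u]].

Definition spectrum_distribution (R : realType) (G : metric R) (lambda : R) :
    \bar R :=
  (\esum_(mu in [set mu : R | laplace_eigenvalue G mu /\ (mu <= lambda)%R])
     multiplicity G mu)%E.

Definition N_ (R : realType) (alpha h lambda : R) : \bar R :=
  spectrum_distribution (g_ alpha h) lambda.

(* Main.v *)
Require Import Defs.
From HB Require Import structures.
From mathcomp Require Import all_boot all_order all_algebra.
From mathcomp Require Import all_classical all_reals all_analysis.
From mathcomp Require Import measurable_realfun.
From mathcomp Require Import ring lra zify.

Import Order.TTheory GRing.Theory Num.Theory.
Import numFieldNormedType.Exports.

Local Open Scope classical_set_scope.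
Local Open Scope ring_scope.

Set Implicit Arguments.
Unset Strict Implicit.
Unset Printing Implicit Defensive.

(** The theorem is a count of lattice points.

    Write e_k (x, y) = cas (2 pi (m x + n y)) for k = (m, n) in Z^2, where
    cas = cos + sin. These Hartley functions form a real orthonormal system with
    exactly one member for each lattice point, and d/dx_i maps e_k to
    2 pi k_i e_(-k). Hence every e_k is an eigenfunction of every homogeneous
    operator of order two with constant coefficients; for the Laplacian of g_h its
    eigenvalue is 4 pi^2 ((m + alpha n)^2 + h^2 (n - alpha m)^2) / (1 + alpha^2) ([eigval]).
    There are no others. If smooth phi_j tend to u and their Laplacians to mu u,
    then Green's formula against e_k ([ip_laplace]) passes to the limit and shows
    that u is orthogonal to e_k unless e_k has the eigenvalue mu; on the other
    hand smooth functions are uniform limits of trigonometric polynomials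
    ([trigpoly_dense]), so u is the sum of its components on the remaining e_k
    ([graph_complete]). The multiplicity of mu is therefore the number of k whose
    eigenvalue is mu ([multiplicityE]), and N_h (lambda) is the number of lattice
    points in an ellipse ([N_lattice]) whose semi-axes are sqrt lambda / (2 pi)
    along F and sqrt lambda / (2 pi h) along H.

    To count them, choose a basis (v, w) of Z^2 and cut the ellipse by the lines
    parallel to v that carry lattice points. Completing the square on each line
    shows that it carries as many points as its chord has lengths of v, up to an
    error of one ([lattice_count]).

    If alpha = p / q, take v = (p, -q), which lies in the direction H. The lines
    that meet the ellipse are then the same for all h, so that the error is
    bounded, and the chords are the terms of the announced sum
    ([rational_case]).

    If alpha is irrational, the component delta of v along F can be made nonzero
    and arbitrarily small ([small_basis]). The number of lines, hence the error
    made on them, is at most C delta / h + C(delta), where C does not depend on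
    delta, and the sum of the chords is a Riemann sum for the area of a half-disc
    ([riemann_half]), equal to lambda / (4 pi h) up to an error that depends on
    delta only ([N_estimate]). Letting h tend to 0 and then delta tend to 0 gives
    [irrational_case]. *)

(** * The metric and its Laplace-Beltrami operator in coordinates *)

Section Geometry.
Context {R : realType}.
Implicit Types (alpha h : R) (u : R * R -> R).

Lemma sum_ord2 (F : 'I_2 -> R) : \sum_(i < 2) F i = F 0 + F 1.
Proof.
by rewrite !big_ord_recl big_ord0 addr0; congr (_ + F _); apply/val_inj.
Qed.

Lemma det2 (A : 'M[R]_2) : \det A = A 0 0 * A 1 1 - A 0 1 * A 1 0.
Proof.
rewrite (expand_det_row _ 0) !big_ord_recl big_ord0 addr0 /cofactor /=.
rewrite !det_mx11 !mxE /= !expr0 !mul1r.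
rewrite (_ : lift ord0 ord0 = 1 :> 'I_2); last exact/val_inj.
rewrite (_ : lift 1 ord0 = 0 :> 'I_2); last exact/val_inj.
by rewrite expr1 mulN1r mulrN.
Qed.

(** The inverse of the matrix of g_h. The matrix of g_h itself has the same form
    with h replaced by its inverse ([gE]), so one formula serves for both. *)
Definition cometric alpha h : 'M[R]_2 :=
  \matrix_(i < 2, j < 2)
    (((if i == 0 then 1 else alpha) * (if j == 0 then 1 else alpha) +
      h ^+ 2 * ((if i == 0 then - alpha else 1) * (if j == 0 then - alpha else 1)))
     / (1 + alpha ^+ 2)).

Lemma gE alpha h p : g_ alpha h p = cometric alpha h^-1.
Proof.
have a0 : 1 + alpha ^+ 2 != 0 by rewrite gt_eqF// ltr_pwDl// sqr_ge0.
apply/matrixP => i j; rewrite !mxE exprVn /g_F /g_H /line_proj /euclid /Fdir /Hdir /ebase /=.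
by case: (i == 0); case: (j == 0) => /=; set k := h ^- 2; field; rewrite ?a0//; apply/eqP; nra.
Qed.

Lemma det_cometric alpha h : \det (cometric alpha h) = h ^+ 2.
Proof.
have a0 : 1 + alpha ^+ 2 != 0 by rewrite gt_eqF// ltr_pwDl// sqr_ge0.
by rewrite det2 !mxE /=; field.
Qed.

Lemma invmx_g alpha h p : h != 0 -> invmx (g_ alpha h p) = cometric alpha h.
Proof.
move=> h0; have a0 : 1 + alpha ^+ 2 != 0 by rewrite gt_eqF// ltr_pwDl// sqr_ge0.
have e : cometric alpha h^-1 *m cometric alpha h = 1%:M.
  apply/matrixP => i j; rewrite !mxE !big_ord_recl big_ord0 !mxE /=.
  case: i => -[|[|//]] ? /=; case: j => -[|[|//]] ? /=;
    rewrite -?val_eqE /=; field; by rewrite ?a0 ?h0.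
have [u1 _] := mulmx1_unit e.
by rewrite gE -[LHS]mulmx1 -e mulmxA mulVmx// mul1mx.
Qed.

Lemma vol_density_g alpha h p : 0 < h -> vol_density (g_ alpha h) p = h^-1.
Proof.
by move=> h0; rewrite /vol_density gE det_cometric sqrtr_sqr ger0_norm// invr_ge0 ltW.
Qed.

Lemma partialZ i (c : R) u p : derivable u p (ebase R i) ->
  partial i (fun r => c * u r) p = c * partial i u p.
Proof. by move=> du; exact: (deriveZ _ du). Qed.

Lemma partialD i u w p : derivable u p (ebase R i) -> derivable w p (ebase R i) ->
  partial i (fun r => u r + w r) p = partial i u p + partial i w p.
Proof. by move=> du dw; exact: (deriveD du dw). Qed.

Lemma laplace_beltrami_g alpha h u z : 0 < h ->
  (forall i j, derivable (partial j u) z (ebase R i)) ->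
  laplace_beltrami (g_ alpha h) u z =
    - \sum_(i < 2) \sum_(j < 2) cometric alpha h i j * partial i (partial j u) z.
Proof.
move=> h0 du; rewrite /laplace_beltrami vol_density_g// invrK; congr (- _).
rewrite mulr_sumr; apply: eq_bigr => i _; rewrite mulr_sumr; apply: eq_bigr => j _.
rewrite (_ : (fun r => _) = fun r => cometric alpha h i j * h^-1 * partial j u r).
  by rewrite partialZ//; field; rewrite gt_eqF.
by apply/funext => r; rewrite invmx_g ?gt_eqF// vol_density_g.
Qed.

Lemma smooth_derivable2 u : smooth_torus u ->
  forall i j z, derivable (partial j u) z (ebase R i).
Proof. by move=> [_ /(_ [:: _])su] i j z; have [_] := su j; exact. Qed.

Lemma vfield2 (v : R * R) u z : (forall i j z, derivable (partial j u) z (ebase R i)) ->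
  vfield v (vfield v u) z =
    v.1 * (v.1 * partial 0 (partial 0 u) z + v.2 * partial 0 (partial 1 u) z) +
    v.2 * (v.1 * partial 1 (partial 0 u) z + v.2 * partial 1 (partial 1 u) z).
Proof.
move=> du; rewrite {1}/vfield /=.
have E i : partial i (vfield v u) z =
    v.1 * partial i (partial 0 u) z + v.2 * partial i (partial 1 u) z.
  have dZ c j : derivable (fun r => c * partial j u r) z (ebase R i).
    by apply: (@derivableZ _ _ _ (partial j u)); exact: du.
  by rewrite partialD// !partialZ.
by rewrite !E.
Qed.

Lemma laplace_beltrami_vfield alpha h u z : 0 < h -> smooth_torus u ->
  laplace_beltrami (g_ alpha h) u z =
        - (1 / (1 + alpha ^+ 2) *
             vfield (1, alpha) (vfield (1, alpha) u) z)
        - h ^+ 2 / (1 + alpha ^+ 2) *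
             vfield (- alpha, 1) (vfield (- alpha, 1) u) z.
Proof.
move=> h0 /smooth_derivable2 du; rewrite laplace_beltrami_g// !vfield2//=.
have a0 : 1 + alpha ^+ 2 != 0 by rewrite gt_eqF// ltr_pwDl// sqr_ge0.
have E (M : 'M[R]_2) (d : 'I_2 -> 'I_2 -> R) : \sum_(i < 2) \sum_(j < 2) M i j * d i j =
    (M 0 0 * d 0 0 + M 0 1 * d 0 1) + (M 1 0 * d 1 0 + M 1 1 * d 1 1).
  by rewrite sum_ord2; congr (_ + _); rewrite sum_ord2.
rewrite (E _ (fun i j => partial i (partial j u) z)) !mxE /=.
move: (partial 0 (partial 0 u) z) (partial 0 (partial 1 u) z) => a b.
move: (partial 1 (partial 0 u) z) (partial 1 (partial 1 u) z) => c d.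
by field.
Qed.

End Geometry.

(** * Square-integrable functions *)

Section SquareIntegrable.
Context d (T : measurableType d) {R : realType} (mu : {measure set T -> \bar R}) (D : set T).
Context (mD : measurable D).
Implicit Types u v w e : T -> R.

Definition sqint u :=
  measurable_fun [set: T] u /\ mu.-integrable D (EFin \o (fun x => u x ^+ 2)).

Definition inner u v : R := \int[mu]_(x in D) (u x * v x).

Lemma sqint_mul u v : sqint u -> sqint v ->
  mu.-integrable D (EFin \o (fun x => u x * v x)).
Proof.
move=> [mu_ iu] [mv iv].
apply: (@le_integrable _ _ _ mu D mD _ (EFin \o (fun x => u x ^+ 2 + v x ^+ 2))).
- apply/measurable_EFinP; apply: measurable_funM; exact: measurable_funTS.
- move=> x _ /=; rewrite lee_fin [leRHS]ger0_norm ?addr_ge0 ?sqr_ge0//.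
  by rewrite ler_norml; apply/andP; split; nra.
- exact: (integrableD mD iu iv).
Qed.

Lemma sqintZ c u : sqint u -> sqint (fun x => c * u x).
Proof.
move=> [mu_ iu]; split; first exact: measurable_funM.
rewrite (_ : _ \o _ = (fun x => (c ^+ 2)%:E * (u x ^+ 2)%:E)%E); last first.
  by apply/funext => x /=; rewrite exprMn.
exact: (integrableZl mD _ iu).
Qed.

Lemma sqintD u v : sqint u -> sqint v -> sqint (fun x => u x + v x).
Proof.
move=> su sv; have iuv := sqint_mul su sv; move: su sv => [mu_ iu] [mv iv].
split; first exact: measurable_funD.
apply: (@le_integrable _ _ _ mu D mD _ (EFin \o (fun x => 2 * (u x ^+ 2 + v x ^+ 2)))).
- apply/measurable_EFinP; apply: measurable_funX; apply: measurable_funTS.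
  exact: measurable_funD.
- move=> x _ /=; rewrite lee_fin !ger0_norm ?sqr_ge0//; last by apply: mulr_ge0 => //; rewrite addr_ge0 ?sqr_ge0.
  by have := sqr_ge0 (u x - v x); nra.
- rewrite (_ : _ \o _ = (fun x => 2%:E * ((u x ^+ 2)%:E + (v x ^+ 2)%:E))%E)//.
  exact: (integrableZl mD _ (integrableD mD iu iv)).
Qed.

Lemma sqintB u v : sqint u -> sqint v -> sqint (fun x => u x - v x).
Proof.
move=> su /(sqintZ (-1)) sv; rewrite (_ : (fun x => _) = (fun x => u x + -1 * v x)).
  exact: sqintD.
by apply/funext => x; rewrite mulN1r.
Qed.

Lemma sqint0 : sqint (fun=> 0).
Proof.
split; first exact: measurable_cst.
rewrite (_ : _ \o _ = cst 0%E); first exact: integrable0.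
by apply/funext => x /=; rewrite expr0n.
Qed.

Lemma sqint_sum (I : Type) (s : seq I) (F : I -> T -> R) :
  (forall i, sqint (F i)) -> sqint (fun x => \sum_(i <- s) F i x).
Proof.
move=> sF; elim: s => [|i s ih].
  rewrite (_ : (fun x => _) = fun=> 0); first exact: sqint0.
  by apply/funext => x; rewrite big_nil.
rewrite (_ : (fun x => _) = (fun x => F i x + \sum_(i <- s) F i x)).
  exact: sqintD.
by apply/funext => x; rewrite big_cons.
Qed.

Lemma ipC u v : inner u v = inner v u.
Proof. by apply: eq_Rintegral => x _; rewrite mulrC. Qed.

Lemma ipZl c u v : sqint u -> sqint v -> inner (fun x => c * u x) v = c * inner u v.
Proof.
move=> su sv; rewrite /inner -RintegralZl//; last exact: sqint_mul.
by apply: eq_Rintegral => x _; rewrite mulrA.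
Qed.

Lemma ipDl u v w : sqint u -> sqint v -> sqint w ->
  inner (fun x => u x + v x) w = inner u w + inner v w.
Proof.
move=> su sv sw; rewrite /inner -RintegralD//; try exact: sqint_mul.
by apply: eq_Rintegral => x _; rewrite mulrDl.
Qed.

Lemma ipBl u v w : sqint u -> sqint v -> sqint w ->
  inner (fun x => u x - v x) w = inner u w - inner v w.
Proof.
move=> su sv sw; have := ipDl su (sqintZ (-1) sv) sw.
rewrite ipZl// mulN1r => <-; by apply: eq_Rintegral => x _; rewrite mulN1r.
Qed.

Lemma ip_suml (I : Type) (s : seq I) (F : I -> T -> R) w :
  (forall i, sqint (F i)) -> sqint w ->
  inner (fun x => \sum_(i <- s) F i x) w = \sum_(i <- s) inner (F i) w.
Proof.
move=> sF sw; elim: s => [|i s ih].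
  rewrite big_nil /inner (@eq_Rintegral _ _ _ _ _ (fun=> 0)); last first.
    by move=> x _; rewrite big_nil mul0r.
  by rewrite Rintegral_cst ?mul0r.
rewrite big_cons -ih -ipDl//; last exact: sqint_sum.
by apply: eq_Rintegral => x _; rewrite big_cons.
Qed.

Lemma ip_ge0 u : 0 <= inner u u.
Proof. by apply: Rintegral_ge0 => x _; rewrite -expr2 sqr_ge0. Qed.

Lemma ipBB u v : sqint u -> sqint v ->
  inner (fun x => u x - v x) (fun x => u x - v x) = inner u u - 2 * inner u v + inner v v.
Proof.
move=> su sv; have sB := sqintB su sv.
by rewrite ipBl// !(ipC _ (fun x => u x - v x)) !ipBl// (ipC v u); ring.
Qed.

(** The norm of [w] minus its projection on [e] is nonnegative. This case of Bessel's
    inequality does the work of Cauchy-Schwarz in all passages to the limit. *)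
Lemma bessel1 w e : sqint w -> sqint e -> inner e e = 1 -> inner w e ^+ 2 <= inner w w.
Proof.
move=> sw se e1; have := ip_ge0 (fun x => w x - inner w e * e x).
have sZ := sqintZ (inner w e) se.
by rewrite ipBB// (ipC w) !ipZl// (ipC e (fun x => _ * _)) ipZl// e1 (ipC e w); nra.
Qed.

(** The norms of the sum and of the difference add up to the right-hand side. *)
Lemma ip_add_le u v : sqint u -> sqint v ->
  inner (fun x => u x + v x) (fun x => u x + v x) <= 2 * inner u u + 2 * inner v v.
Proof.
move=> su sv; have sD := sqintD su sv; have := ip_ge0 (fun x => u x - v x).
by rewrite ipBB// ipDl// !(ipC _ (fun x => u x + v x)) !ipDl// (ipC v u); nra.
Qed.

Lemma integral_sq u : sqint u -> (\int[mu]_(x in D) (u x ^+ 2)%:E)%E = (inner u u)%:E.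
Proof.
move=> [mu_ iu]; rewrite /inner /Rintegral fineK; last first.
  by apply: integrable_fin_num => //; move: iu; congr (integrable _ _ _).
by apply: eq_integral => x _.
Qed.

Lemma ip_eq0_ae u : sqint u -> inner u u = 0 -> {ae mu, forall x, D x -> u x = 0}.
Proof.
move=> su u0; have := integral_sq su; rewrite u0 => i0.
have [_ +] := ae_eq_integral_abs mu mD (measurable_int _ su.2).
have [+ _] := ae_eq_integral_abs mu mD (measurable_int _ su.2).
move=> H _; have {H} : ae_eq mu D (EFin \o (fun x => u x ^+ 2)) (cst 0%E).
  apply: H; rewrite -[RHS]i0; apply: eq_integral => x _ /=.
  by rewrite ger0_norm// sqr_ge0.
apply: filterS => x H Dx; have /= [] := H Dx.
by move/eqP; rewrite sqrf_eq0 => /eqP.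
Qed.

End SquareIntegrable.

(** * Periodic functions on the plane *)

(** The set function [leb2] together with its structure of measure, which the
    lemmas on integrals refer to. *)
Definition plane_measure (R : realType) :
    {measure set (measurableTypeR R * measurableTypeR R)%type -> \bar R} :=
  (@lebesgue_measure R \x @lebesgue_measure R)%E.

Section Torus.
Context {R : realType}.
Implicit Types (f : R * R -> R).
Local Notation T2 := (measurableTypeR R * measurableTypeR R)%type.
Local Notation S := (@unit_square R).

(** An open set is the union of the rational boxes that it contains, and these
    are countably many. *)
Lemma open_measurable_plane (U : set (R * R)) : open U -> measurable (U : set T2).
Proof.
move=> oU.
pose box (i : (rat * rat) * (rat * rat)) : set T2 :=
  `]ratr i.1.1, ratr i.1.2[%classic `*` `]ratr i.2.1, ratr i.2.2[%classic.
pose F i := if `[< box i `<=` U >] then box i else set0.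
rewrite (_ : U = \bigcup_i F i).
  apply: countable_bigcupT_measurable => // i; rewrite /F.
  by case: ifPn => // _; apply: measurableX; exact: measurable_itv.
apply/seteqP; split => [[x y] Uxy|p [i _]]; last first.
  by rewrite /F; case: ifPn => // /asboolP + Fp; apply.
have /nbhs_ballP[e /= e0 eU] : nbhs (x, y) U by rewrite nbhsE; exists U.
have [a] := @rat_in_itvoo _ (x - e) x ltac:(lra).
have [b] := @rat_in_itvoo _ x (x + e) ltac:(lra).
have [c] := @rat_in_itvoo _ (y - e) y ltac:(lra).
have [d] := @rat_in_itvoo _ y (y + e) ltac:(lra).
rewrite !in_itv /= => /andP[? ?] /andP[? ?] /andP[? ?] /andP[? ?].
exists ((a, b), (c, d)) => //; rewrite /F asboolT; last first.
  move=> [s t] [/=]; rewrite !in_itv /= => /andP[? ?] /andP[? ?].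
  by apply: eU; split => /=; rewrite /ball /= ltr_distlC; apply/andP; split; lra.
by split => /=; rewrite in_itv /=; apply/andP; split.
Qed.

Lemma continuous_measurable_plane f : continuous f -> measurable_fun [set: T2] f.
Proof.
move=> /continuousP cf; apply: (measurability _ (RGenOpens.measurableE R)).
move=> _ [_ [a [b ->] <-]]; rewrite setTI; apply: open_measurable_plane.
exact/cf/interval_open.
Qed.

Lemma measurable_unit_square : measurable (S : set T2).
Proof. by apply: measurableX; exact: measurable_itv. Qed.

Lemma plane_measure_unit_square : plane_measure R (S : set T2) = 1%E.
Proof.
have H : lebesgue_measure (`[0%R, 1%R[%classic : set R) = 1%E :> \bar R.
  by rewrite lebesgue_measure_itv /= lte_fin ltr01 oppr0 adde0.
rewrite -[LHS]/((lebesgue_measure \x lebesgue_measure)%E (S : set T2)).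
rewrite product_measure1E; try exact: measurable_itv.
by rewrite [X in (X * _)%E]H [X in (_ * X)%E]H mule1.
Qed.

Lemma torus_fun_nat f (m n : nat) x y : torus_fun f -> f (x + m%:R, y + n%:R) = f (x, y).
Proof.
move=> tf; elim: m => [|m ih].
  rewrite addr0; elim: n => [|n ih]; first by rewrite addr0.
  by rewrite -natr1 addrA (tf _ _).2.
by rewrite -natr1 addrA (tf _ _).1.
Qed.

Lemma torus_fun_int f (m n : int) x y : torus_fun f -> f (x + m%:~R, y + n%:~R) = f (x, y).
Proof.
move=> tf; have H (k : int) : exists a b : nat, k%:~R = a%:R - b%:R :> R.
  case: k => k; first by exists k, 0%N; rewrite subr0.
  by exists 0%N, k.+1; rewrite NegzE mulrNz sub0r.
have [a [b ->]] := H m; have [c [d ->]] := H n.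
rewrite -(@torus_fun_nat _ b d _ _ tf) -(@torus_fun_nat _ a c x y tf).
by congr (f (_, _)); ring.
Qed.

(** By periodicity, the supremum over the compact unit square is global. *)
Lemma torus_fun_bounded f : torus_fun f -> continuous f ->
  exists2 M : R, 0 < M & forall p, `|f p| <= M.
Proof.
move=> tf cf.
have cK : compact (`[0, 1]%classic `*` `[0, 1]%classic : set (R * R)).
  by apply: compact_setX; exact: segment_compact.
have := continuous_compact (continuous_subspaceT cf) cK.
move=> /compact_bounded[M [Mr HM]].
exists (`|M| + 1); first by rewrite ltr_pwDr.
move=> [x y]; rewrite -(@torus_fun_int _ (- Num.floor x) (- Num.floor y) _ _ tf).
apply: (HM (`|M| + 1)); first by rewrite ltr_pwDr// ler_norm.
have := floor_itv x; have := floor_itv y; rewrite !intrD => /andP[? ?] /andP[? ?].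
exists (x + (- Num.floor x)%:~R, y + (- Num.floor y)%:~R) => //.
by split => /=; rewrite in_itv /= !mulrNz; apply/andP; split; lra.
Qed.

Lemma sqint_continuous f : torus_fun f -> continuous f -> sqint (plane_measure R) (S : set T2) f.
Proof.
move=> tf cf; split; first exact: continuous_measurable_plane.
apply: measurable_bounded_integrable; first exact: measurable_unit_square.
- by rewrite plane_measure_unit_square ltry.
- by apply: measurable_funTS; apply: measurable_funX; exact: continuous_measurable_plane.
- have [M M0 HM] := torus_fun_bounded tf cf.
  exists (M ^+ 2); split; first exact: num_real.
  move=> N MN p _ /=; rewrite normrX (le_trans _ (ltW MN))//.
  by rewrite lerXn2r// ?nnegrE// ltW.
Qed.

End Torus.

(** * Integrals of derivatives over a period *)

Section Divergence.
Context {R : realType}.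
Implicit Types (f : R * R -> R).
Local Notation T2 := (measurableTypeR R * measurableTypeR R)%type.
Local Notation S := (@unit_square R).
Local Notation mu := (plane_measure R).

(** The difference quotients, and not only their limits, agree with those of the
    slices; derivability and derivatives transfer at once. *)
Lemma quotient0 f (x y : R) :
  (fun h : R => h^-1 *: ((f \o shift (x, y)) (h *: ebase R 0) - f (x, y))) =
  (fun h : R => h^-1 *: (((fun t : R => f (t, y)) \o shift x) (h *: (1 : R)) - f (x, y))).
Proof.
apply/funext => h; rewrite /ebase /=; congr (_ *: (f _ - _)).
by congr pair; rewrite /= scaler0 add0r.
Qed.

Lemma quotient1 f (x y : R) :
  (fun h : R => h^-1 *: ((f \o shift (x, y)) (h *: ebase R 1) - f (x, y))) =
  (fun h : R => h^-1 *: (((fun t : R => f (x, t)) \o shift y) (h *: (1 : R)) - f (x, y))).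
Proof.
apply/funext => h; rewrite /ebase /=; congr (_ *: (f _ - _)).
by congr pair; rewrite /= scaler0 add0r.
Qed.

Lemma slice0 f (x y : R) : derivable f (x, y) (ebase R 0) =
  derivable (fun t : R => f (t, y)) x 1.
Proof. by rewrite /derivable quotient0. Qed.

Lemma slice1 f (x y : R) : derivable f (x, y) (ebase R 1) =
  derivable (fun t : R => f (x, t)) y 1.
Proof. by rewrite /derivable quotient1. Qed.

Lemma partial0E f (x y : R) : partial 0 f (x, y) = (fun t : R => f (t, y))^`()%classic x.
Proof. by rewrite derive1E /partial /derive quotient0. Qed.

Lemma partial1E f (x y : R) : partial 1 f (x, y) = (fun t : R => f (x, t))^`()%classic y.
Proof. by rewrite derive1E /partial /derive quotient1. Qed.

Lemma integral_derive1_period (f g : R -> R) : continuous g ->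
  (forall x, derivable f x 1) -> f^`()%classic =1 g -> f 1 = f 0 ->
  (\int[lebesgue_measure]_(x in `[0%R, 1%R[) (g x)%:E = 0)%E.
Proof.
move=> cg df fg f10; rewrite integral_itv_bndo_bndc; last first.
  apply/measurable_EFinP; apply: measurable_funTS.
  exact: continuous_measurable_fun.
rewrite (@continuous_FTC2 R g f)//.
- by rewrite f10 subee.
- exact: continuous_subspaceT.
- have cf x : f z @[z --> x] --> f x.
    by apply: differentiable_continuous; apply/derivable1_diffP.
  split; first by move=> x _.
  + exact: cvg_at_right_filter.
  + exact: cvg_at_left_filter.
Qed.

Lemma continuous_pair2 (g : R * R -> R) : continuous g ->
  forall y, continuous (fun x => g (x, y)).
Proof.
move=> cg y x; apply: (@continuous_comp _ _ _ (fun x : R => (x, y)) g); last exact: cg.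
exact: (@cvg_pair _ _ _ (nbhs x) (nbhs x) (nbhs y) _ _ _ id (cst y)
  (@cvg_id _ _) (@cvg_cst _ _ _ _ _)).
Qed.

Lemma continuous_pair1 (g : R * R -> R) : continuous g ->
  forall x, continuous (fun y => g (x, y)).
Proof.
move=> cg x y; apply: (@continuous_comp _ _ _ (fun y : R => (x, y)) g); last exact: cg.
exact: (@cvg_pair _ _ _ (nbhs y) (nbhs x) (nbhs y) _ _ _ (cst x) id
  (@cvg_cst _ _ _ _ _) (@cvg_id _ _)).
Qed.

Lemma integrable_continuous_torus f : torus_fun f -> continuous f ->
  mu.-integrable (S : set T2) (EFin \o f).
Proof.
move=> tf cf; apply: measurable_bounded_integrable.
- exact: measurable_unit_square.
- by rewrite plane_measure_unit_square ltry.
- by apply: measurable_funTS; exact: continuous_measurable_plane.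
- have [M M0 HM] := torus_fun_bounded tf cf.
  exists M; split; first exact: num_real.
  by move=> N MN p _ /=; rewrite (le_trans _ (ltW MN)).
Qed.

(** Fubini's theorem puts the variable of differentiation innermost, where the
    integral over a period is the difference of the values at 0 and 1. *)
Lemma Rintegral_partial i f : torus_fun f -> torus_fun (partial i f) ->
  continuous (partial i f) -> (forall p, derivable f p (ebase R i)) ->
  \int[mu]_(p in (S : set T2)) partial i f p = 0.
Proof.
move=> tf tg cg df; have ig := integrable_continuous_torus tg cg.
rewrite /Rintegral (_ : (\int[_]_(_ in _) _)%E = 0%E)// integral_mkcond.
have {ig} := (integrable_mkcond _ measurable_unit_square).1 ig => ig.
have [i0|i1] : i = 0 \/ i = 1.
  by case: i {tg cg df ig} => -[|[|//]] ?; [left|right]; exact/val_inj.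
- rewrite -[LHS](integral21_prod_meas1 ig) integral0_eq// => y _; rewrite /fubini_G.
  have [yS|yS] := boolP (y \in `[0, 1[); last first.
    rewrite integral0_eq// => x _; rewrite /patch memNset// => -[_ /=].
    by rewrite (negbTE yS).
  rewrite -[RHS](@integral_derive1_period (fun x => f (x, y)) (fun x => partial i f (x, y))).
  + rewrite [RHS]integral_mkcond; apply: eq_integral => x _; rewrite /patch.
    congr (if _ then _ else _); apply/idP/idP; rewrite !inE.
      by case.
    by split.
  + exact: continuous_pair2.
  + by move=> x; rewrite -slice0 -i0.
  + by move=> x; rewrite -partial0E i0.
  + by have := (tf 0 y).1; rewrite add0r.
- rewrite -[LHS](integral12_prod_meas1 ig) integral0_eq// => x _; rewrite /fubini_F.
  have [xS|xS] := boolP (x \in `[0, 1[); last first.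
    rewrite integral0_eq// => y _; rewrite /patch memNset// => -[/=].
    by rewrite (negbTE xS).
  rewrite -[RHS](@integral_derive1_period (fun y => f (x, y)) (fun y => partial i f (x, y))).
  + rewrite [RHS]integral_mkcond; apply: eq_integral => y _; rewrite /patch.
    congr (if _ then _ else _); apply/idP/idP; rewrite !inE.
      by case.
    by split.
  + exact: continuous_pair1.
  + by move=> y; rewrite -slice1 -i1.
  + by move=> y; rewrite -partial1E i1.
  + by have := (tf x 0).2; rewrite add0r.
Qed.

End Divergence.

(** * The Hartley functions *)

Section Hartley.
Context {R : realType}.
Implicit Types (f : R * R -> R) (k l : int * int) (t a b : R).
Local Notation T2 := (measurableTypeR R * measurableTypeR R)%type.
Local Notation S := (@unit_square R).
Local Notation mu := (plane_measure R).

Definition cas t : R := cos t + sin t.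

Definition freq (i : 'I_2) k : R := if i == 0 then k.1%:~R else k.2%:~R.

(** The use of cas in place of sine and cosine yields real functions indexed by all
    of Z^2, without choosing one of k and -k. *)
Definition hartley k (p : R * R) : R :=
  cas (2 * pi * (k.1%:~R * p.1 + k.2%:~R * p.2)).

Lemma freqN i k : freq i (- k) = - freq i k.
Proof. by rewrite /freq; case: ifP; rewrite /= mulrNz. Qed.

Lemma cas_nat t (n : nat) : cas (t + 2 * pi * n%:R) = cas t.
Proof.
elim: n => [|n ih]; first by rewrite mulr0 addr0.
rewrite -[n.+1%:R]natr1 mulrDr mulr1 addrA -[RHS]ih /cas.
by rewrite mulr_natl cosD2pi sinD2pi.
Qed.

Lemma cas_int t (n : int) : cas (t + 2 * pi * n%:~R) = cas t.
Proof.
case: n => n; first exact: cas_nat.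
by rewrite -[LHS](cas_nat _ n.+1) NegzE mulrNz; congr cas; rewrite pmulrn; ring.
Qed.

Lemma torus_hartley k : torus_fun (hartley k).
Proof.
move=> x y; split; rewrite /hartley /=.
- by rewrite -[RHS](cas_int _ k.1); congr cas; ring.
- by rewrite -[RHS](cas_int _ k.2); congr cas; ring.
Qed.

Lemma is_derive_cas_affine a b t :
  is_derive t 1 (fun t => cas (a * t + b)) (a * cas (- (a * t + b))).
Proof.
have da : is_derive t 1 (fun t : R => a * t + b) a.
  have := is_deriveD (is_deriveZ a (is_derive_id t (1 : R))) (is_derive_cst b t (1 : R)).
  by move/is_derive_eq; apply; rewrite addr0 /GRing.scale /= mulr1.
rewrite /cas cosN sinN.
have dc := @is_derive1_comp _ cos (fun t => a * t + b) _ _ _ (is_derive_cos _) da.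
have ds := @is_derive1_comp _ sin (fun t => a * t + b) _ _ _ (is_derive_sin _) da.
have /is_derive_eq := is_deriveD dc ds; apply.
by ring.
Qed.

Lemma hartley_slice0 k y : (fun t => hartley k (t, y)) =
  (fun t => cas (2 * pi * k.1%:~R * t + 2 * pi * (k.2%:~R * y))).
Proof. by apply/funext => t; rewrite /hartley /=; congr cas; ring. Qed.

Lemma hartley_slice1 k x : (fun t => hartley k (x, t)) =
  (fun t => cas (2 * pi * k.2%:~R * t + 2 * pi * (k.1%:~R * x))).
Proof. by apply/funext => t; rewrite /hartley /=; congr cas; ring. Qed.

Lemma derivable_hartley i k p : derivable (hartley k) p (ebase R i).
Proof.
case: p => x y; have [->|->] : i = 0 \/ i = 1.
  by case: i => -[|[|//]] ?; [left|right]; exact/val_inj.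
- by rewrite slice0 hartley_slice0; have [] := is_derive_cas_affine
    (2 * pi * k.1%:~R) (2 * pi * (k.2%:~R * y)) x.
- by rewrite slice1 hartley_slice1; have [] := is_derive_cas_affine
    (2 * pi * k.2%:~R) (2 * pi * (k.1%:~R * x)) y.
Qed.

Lemma partial_hartley i k :
  partial i (hartley k) = fun p => 2 * pi * freq i k * hartley (- k) p.
Proof.
apply/funext => -[x y]; have [->|->] : i = 0 \/ i = 1.
  by case: i => -[|[|//]] ?; [left|right]; exact/val_inj.
- rewrite partial0E hartley_slice0 derive1E.
  have [_ ->] := is_derive_cas_affine (2 * pi * k.1%:~R) (2 * pi * (k.2%:~R * y)) x.
  by congr (_ * cas _); rewrite /= !mulrNz; ring.
- rewrite partial1E hartley_slice1 derive1E.
  have [_ ->] := is_derive_cas_affine (2 * pi * k.2%:~R) (2 * pi * (k.1%:~R * x)) y.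
  by congr (_ * cas _); rewrite /= !mulrNz; ring.
Qed.

Lemma continuous_hartley k : continuous (hartley k).
Proof.
move=> p; apply: (@continuous_comp _ _ _
  (fun p : R * R => 2 * pi * (k.1%:~R * p.1 + k.2%:~R * p.2)) cas).
  apply: cvgM; first exact: cvg_cst.
  by apply: cvgD; (apply: cvgM; first exact: cvg_cst); [exact: cvg_fst|exact: cvg_snd].
by apply: cvgD; [exact: continuous_cos|exact: continuous_sin].
Qed.

(** Hartley functions are permuted by differentiation up to constants, so they have
    derivatives of all orders. *)
Lemma iter_partial_hartley (s : seq 'I_2) k :
  exists c k', iter_partial s (hartley k) = fun p => c * hartley k' p.
Proof.
elim: s => [|i s [c [k' ih]]].
  by exists 1, k; apply/funext => p; rewrite mul1r.
exists (c * (2 * pi * freq i k')), (- k').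
rewrite /= -/(iter_partial s _) ih; apply/funext => p.
by rewrite partialZ ?partial_hartley ?mulrA//; exact: derivable_hartley.
Qed.

Lemma smooth_hartley k : smooth_torus (hartley k).
Proof.
split; first exact: torus_hartley.
move=> s; have [c [k' ->]] := iter_partial_hartley s k; split.
  by move=> p; apply: cvgM; [exact: cvg_cst|exact: continuous_hartley].
by move=> i p; apply: (@derivableZ _ _ _ (hartley k')); exact: derivable_hartley.
Qed.

Lemma sqint_hartley k : sqint mu (S : set T2) (hartley k).
Proof. by apply: sqint_continuous; [exact: torus_hartley|exact: continuous_hartley]. Qed.

Lemma freq_eq0 k : (forall i, freq i k = 0) -> k = 0.
Proof.
move=> k0; have := k0 0; have := k0 1; rewrite /freq /= => /eqP + /eqP.
by rewrite !intr_eq0 => /eqP + /eqP; case: k {k0} => a b /= -> ->.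
Qed.

(** For k <> 0 some frequency of k is nonzero, and then the function is itself a
    partial derivative of a periodic function. *)
Lemma Rintegral_hartley k :
  \int[mu]_(p in (S : set T2)) hartley k p = (k == 0)%:R.
Proof.
have [->|k0] := eqVneq k 0.
  rewrite (@eq_Rintegral _ _ _ _ _ (fun=> 1)); last first.
    by move=> p _; rewrite /hartley /= !mul0r addr0 mulr0 /cas cos0 sin0 addr0.
  rewrite Rintegral_cst; last exact: measurable_unit_square.
  by rewrite plane_measure_unit_square mul1r.
have [i fi] : exists i, freq i k != 0.
  apply/not_existsP => H; case/eqP: k0; apply: freq_eq0 => i.
  by apply/eqP; have /negP := H i; rewrite negbK.
pose c : R := (2 * pi * freq i (- k))^-1.
have c0 : 2 * pi * freq i (- k) != 0.
  by rewrite !mulf_neq0 ?freqN ?oppr_eq0// gt_eqF// pi_gt0.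
have E : partial i (fun p => c * hartley (- k) p) = hartley k.
  apply/funext => p; rewrite partialZ; last exact: derivable_hartley.
  by rewrite partial_hartley opprK mulrA mulVf ?mul1r.
rewrite -[in LHS]E Rintegral_partial// ?E.
- by move=> x y; rewrite !(torus_hartley _ x y).1 !(torus_hartley _ x y).2.
- exact: torus_hartley.
- exact: continuous_hartley.
- by move=> p; apply: (@derivableZ _ _ _ (hartley (- k))); exact: derivable_hartley.
Qed.

(** cas a cas b = cos (a - b) + sin (a + b), with cosine and sine written
    back in terms of cas. *)
Lemma hartleyM k l p : hartley k p * hartley l p =
  2^-1 * (hartley (k - l) p + hartley (l - k) p + hartley (k + l) p - hartley (- (k + l)) p).
Proof.
rewrite /hartley /=; set A := 2 * pi * (k.1%:~R * p.1 + k.2%:~R * p.2).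
set B := 2 * pi * (l.1%:~R * p.1 + l.2%:~R * p.2).
have -> : 2 * pi * ((k - l).1%:~R * p.1 + (k - l).2%:~R * p.2) = A - B.
  by rewrite /= !intrB /A /B; ring.
have -> : 2 * pi * ((l - k).1%:~R * p.1 + (l - k).2%:~R * p.2) = - (A - B).
  by rewrite /= !intrB /A /B; ring.
have -> : 2 * pi * ((k + l).1%:~R * p.1 + (k + l).2%:~R * p.2) = A + B.
  by rewrite /= !intrD /A /B; ring.
have -> : 2 * pi * ((- (k + l)).1%:~R * p.1 + (- (k + l)).2%:~R * p.2) = - (A + B).
  by rewrite /= !mulrNz !intrD /A /B; ring.
rewrite /cas !cosN !sinN cosB sinB cosD sinD.
by field.
Qed.

Lemma ip_hartley k l : inner mu (S : set T2) (hartley k) (hartley l) = (k == l)%:R.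
Proof.
have ih k' := integrable_continuous_torus (torus_hartley k') (continuous_hartley (k := k')).
have mS := @measurable_unit_square R.
rewrite /inner (@eq_Rintegral _ T2 _ _ _ (fun p =>
  2^-1 * ((hartley (k - l) p + hartley (l - k) p) +
          (hartley (k + l) p - hartley (- (k + l)) p)))); last first.
  by move=> p _; rewrite hartleyM; ring.
have iD m n := integrableD mS (ih m) (ih n).
have iB m n := integrableB mS (ih m) (ih n).
rewrite RintegralZl//; last exact: (integrableD mS (iD _ _) (iB _ _)).
rewrite RintegralD//; [|exact: iD|exact: iB].
rewrite RintegralD// RintegralB// !Rintegral_hartley oppr_eq0 subrr addr0.
by rewrite !subr_eq0 (eq_sym l k); field.
Qed.

End Hartley.

(** * Green's formula *)

Section Green.
Context {R : realType}.
Implicit Types (f : R * R -> R) (k : int * int) (alpha h : R).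
Local Notation T2 := (measurableTypeR R * measurableTypeR R)%type.
Local Notation S := (@unit_square R).
Local Notation mu := (plane_measure R).
Local Notation ip := (inner mu (S : set T2)).

(** The difference quotients of a function with period [q] have the period [q]. *)
Lemma torus_partial i f : torus_fun f -> torus_fun (partial i f).
Proof.
move=> tf x y; rewrite /partial /derive.
suff E q : (forall p, f (p + q) = f p) -> forall p,
    (fun h : R => h^-1 *: ((f \o shift (p + q)) (h *: ebase R i) - f (p + q))) =
    (fun h : R => h^-1 *: ((f \o shift p) (h *: ebase R i) - f p)).
  split.
  - have := E (1, 0) _ (x, y); rewrite [(x, y) + (1, 0)](_ : _ = (x + 1, y)).
      by move=> ->// -[a b]; rewrite -(tf a b).1; congr (f (_, _)); rewrite /= addr0.
    by congr pair; rewrite /= addr0.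
  - have := E (0, 1) _ (x, y); rewrite [(x, y) + (0, 1)](_ : _ = (x, y + 1)).
      by move=> ->// -[a b]; rewrite -(tf a b).2; congr (f (_, _)); rewrite /= addr0.
    by congr pair; rewrite /= addr0.
by move=> fq p; apply/funext => h /=; rewrite addrA !fq.
Qed.

Lemma smooth_partial i f : smooth_torus f -> smooth_torus (partial i f).
Proof.
move=> [tf sf]; split; first exact: torus_partial.
move=> s; have := sf (rcons s i).
by rewrite /iter_partial foldr_rcons.
Qed.

Lemma smooth_continuous f : smooth_torus f -> continuous f.
Proof. by move=> [_ /(_ [::])[]]. Qed.

Lemma smooth_derivable f i p : smooth_torus f -> derivable f p (ebase R i).
Proof. by move=> [_ /(_ [::])[]]. Qed.

Lemma sqint_smooth f : smooth_torus f -> sqint mu (S : set T2) f.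
Proof. by move=> sf; apply: sqint_continuous; [case: sf|exact: smooth_continuous]. Qed.

(** Integration by parts: the derivative of [f * hartley k] has integral zero. *)
Lemma ip_partial i f k : smooth_torus f ->
  ip (partial i f) (hartley k) = - (2 * pi * freq i k) * ip f (hartley (- k)).
Proof.
move=> sf.
have spf := smooth_partial i sf.
have dfh p : derivable (fun p => f p * hartley k p) p (ebase R i).
  by apply: (@derivableM _ _ f (hartley k)); [exact: smooth_derivable|exact: derivable_hartley].
have E : partial i (fun p => f p * hartley k p) =
    (fun p => partial i f p * hartley k p + 2 * pi * freq i k * (f p * hartley (- k) p)).
  apply/funext => p.
  have := @deriveM _ _ f (hartley k) p (ebase R i) (smooth_derivable sf) (@derivable_hartley _ i k p).
  rewrite -[X in _ = _ + hartley k p *: X]/(partial i f p).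
  rewrite -[X in _ = f p *: X + _]/(partial i (hartley k) p) partial_hartley /GRing.scale /=.
  by rewrite -[LHS]/(partial i (f * hartley k) p) => ->; ring.
have tP : torus_fun (fun p => f p * hartley k p).
  by move=> x y; rewrite !(torus_hartley _ x y).1 !(torus_hartley _ x y).2 !(sf.1 x y).1 !(sf.1 x y).2.
have cc (u v : R * R -> R) : continuous u -> continuous v ->
    continuous (fun p => u p * v p).
  by move=> cu cv p; apply: cvgM; [exact: cu|exact: cv].
have cE : continuous (partial i (fun p => f p * hartley k p)).
  rewrite E => p; apply: cvgD.
    by apply: cc; [exact: smooth_continuous|exact: continuous_hartley].
  apply: cvgM; first exact: cvg_cst.
  by apply: cc; [exact: smooth_continuous|exact: continuous_hartley].
have := Rintegral_partial tP (torus_partial i tP) cE dfh; rewrite E.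
have i1 := sqint_mul measurable_unit_square (sqint_smooth spf) (sqint_hartley k).
have i2 := sqint_mul measurable_unit_square (sqint_smooth sf) (sqint_hartley (- k)).
rewrite RintegralD//; [|exact: measurable_unit_square|exact: (integrableZl measurable_unit_square _ i2)].
rewrite RintegralZl//; last exact: measurable_unit_square.
by rewrite /inner => /eqP; rewrite addr_eq0 => /eqP ->; ring.
Qed.

Definition eigval alpha h k : R :=
  4 * pi ^+ 2 / (1 + alpha ^+ 2) *
  ((k.1%:~R + alpha * k.2%:~R) ^+ 2 + h ^+ 2 * (k.2%:~R - alpha * k.1%:~R) ^+ 2).

Lemma eigvalE alpha h k : eigval alpha h k =
  4 * pi ^+ 2 * \sum_(i < 2) \sum_(j < 2) cometric alpha h i j * (freq i k * freq j k).
Proof.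
have a0 : 1 + alpha ^+ 2 != 0 by rewrite gt_eqF// ltr_pwDl// sqr_ge0.
by rewrite !sum_ord2 /eigval !mxE /freq /=; field.
Qed.

(** Two integrations by parts change k into -k and back, which leaves the two signs
    of [freqN] to cancel the leading minus of the Laplacian. *)
Lemma ip_laplace alpha h f k : 0 < h -> smooth_torus f ->
  ip (laplace_beltrami (g_ alpha h) f) (hartley k) = eigval alpha h k * ip f (hartley k).
Proof.
move=> h0 sf; have mS := @measurable_unit_square R.
have sp i j : sqint mu (S : set T2) (partial i (partial j f)).
  by apply: sqint_smooth; do 2 apply: smooth_partial.
have sk := sqint_hartley k.
pose g p := \sum_(i < 2) \sum_(j < 2) cometric alpha h i j * partial i (partial j f) p.
have -> : laplace_beltrami (g_ alpha h) f = fun p => -1 * g p.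
  apply/funext => p; rewrite laplace_beltrami_g// ?mulN1r//.
  by move=> i j; apply: smooth_derivable; exact: smooth_partial.
rewrite ipZl//; last by do 2 (apply: sqint_sum => // ?); exact: sqintZ.
rewrite ip_suml//; last by move=> ?; apply: sqint_sum => // ?; exact: sqintZ.
rewrite eigvalE mulr_sumr [4 * _ * _]mulr_sumr mulr_suml.
apply: eq_bigr => i _; rewrite ip_suml//; last by move=> ?; exact: sqintZ.
rewrite mulr_sumr [4 * _ * _]mulr_sumr mulr_suml; apply: eq_bigr => j _.
rewrite ipZl// ip_partial; last exact: smooth_partial.
by rewrite ip_partial// freqN opprK; ring.
Qed.

Lemma laplace_hartley alpha h k p : 0 < h ->
  laplace_beltrami (g_ alpha h) (hartley k) p = eigval alpha h k * hartley k p.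
Proof.
move=> h0; rewrite laplace_beltrami_g//; last first.
  by move=> i j; apply: smooth_derivable; apply: smooth_partial; exact: smooth_hartley.
rewrite eigvalE [4 * _ * _]mulr_sumr mulr_suml -sumrN; apply: eq_bigr => i _.
rewrite mulr_sumr mulr_suml -sumrN; apply: eq_bigr => j _.
rewrite partial_hartley partialZ; last exact: derivable_hartley.
by rewrite partial_hartley freqN opprK; ring.
Qed.

End Green.

(** * The Fejer kernel *)

Section Fejer.
Context {R : realType}.
Implicit Types (x t : R).

Lemma cos_int t (n : int) : cos (t + 2 * pi * n%:~R) = cos t.
Proof.
have H (u : R) (m : nat) : cos (u + 2 * pi * m%:R) = cos u.
  elim: m => [|m ih]; first by rewrite mulr0 addr0.
  by rewrite -[RHS]ih -[in RHS]cosD2pi -natr1; congr cos; rewrite -[m.+1%:R]natr1; ring.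
case: n => n; first exact: H.
by rewrite -[LHS](H _ n.+1) NegzE mulrNz; congr cos; rewrite pmulrn; ring.
Qed.

(** After multiplication by sin (pi d / M) the sum telescopes over a full period;
    that sine is nonzero because 0 < d < M. *)
Lemma sum_cos_samples (M d : nat) x : (0 < d < M)%N ->
  \sum_(0 <= a < M) cos (2 * pi * d%:R * (x - a%:R / M%:R)) = 0.
Proof.
move=> /andP[d0 dM].
have M0 : 0 < M%:R :> R by rewrite ltr0n (leq_ltn_trans _ dM).
pose e : R := pi * d%:R / M%:R.
have e0 : 0 < sin e.
  apply: sin_gt0_pi; apply/andP; split.
    by rewrite !mulr_gt0 ?pi_gt0 ?ltr0n ?invr_gt0.
  by rewrite /e -mulrA gtr_pMr ?pi_gt0// ltr_pdivrMr// mul1r ltr_nat.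
pose g (a : nat) := - sin (2 * pi * d%:R * x - 2 * e * a%:R + e).
have E a : cos (2 * pi * d%:R * (x - a%:R / M%:R)) * (2 * sin e) = g a.+1 - g a.
  have -> : 2 * pi * d%:R * (x - a%:R / M%:R) = 2 * pi * d%:R * x - 2 * e * a%:R.
    by rewrite /e; field; rewrite gt_eqF.
  rewrite /g; set p := 2 * pi * d%:R * x; set q := 2 * e * a%:R.
  have -> : p - 2 * e * a.+1%:R + e = (p - q) - e by rewrite /q; ring.
  by move: (p - q) => u; rewrite sinB sinD; ring.
have gM : g M = g 0.
  rewrite /g -!cosBpihalf; congr (- _); rewrite -[RHS](cos_int _ (- d%:Z)); congr cos.
  by rewrite mulrNz /e -pmulrn; field; rewrite gt_eqF.
suff : (\sum_(0 <= a < M) cos (2 * pi * d%:R * (x - a%:R / M%:R))) * (2 * sin e) = 0.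
  by move/eqP; rewrite mulf_eq0 => /orP[/eqP//|]; rewrite mulf_eq0 pnatr_eq0 /= gt_eqF.
rewrite mulr_suml (eq_bigr (fun a => g a.+1 - g a)) ?telescope_sumr ?gM ?subrr//.
Qed.

Lemma mean_cos_samples (M : nat) (d : int) x : (0 < M)%N -> (`|d| < M)%N ->
  \sum_(0 <= a < M) cos (2 * pi * d%:~R * (x - a%:R / M%:R)) = M%:R * (d == 0)%:R.
Proof.
move=> M0 dM; have [->|d0] := eqVneq d 0.
  rewrite (eq_bigr (fun=> 1)) ?mulr1; last by move=> a _; rewrite mulr0 mul0r cos0.
  by rewrite sumr_const_nat subn0.
rewrite mulr0 -[RHS](@sum_cos_samples M `|d|%N x) ?absz_gt0 ?d0//.
apply: eq_bigr => a _; case: d {dM d0} => d //=.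
by rewrite NegzE mulrNz -cosN; congr cos; rewrite -pmulrn; ring.
Qed.

(** Written as a double sum, the kernel is a sum of two squares divided by n, and its
    Fourier coefficients need not be collected. *)
Definition fejer (n : nat) t : R :=
  n%:R^-1 * \sum_(i < n) \sum_(j < n) cos (2 * pi * (i%:R - j%:R) * t).

Lemma fejer_ge0 n t : 0 <= fejer n t.
Proof.
rewrite /fejer mulr_ge0 ?invr_ge0 ?ler0n//.
pose A (i : 'I_n) := 2 * pi * i%:R * t.
rewrite (_ : \sum_i _ = (\sum_i cos (A i)) ^+ 2 + (\sum_i sin (A i)) ^+ 2).
  by rewrite addr_ge0 ?sqr_ge0.
rewrite !expr2 !mulr_suml -big_split; apply: eq_bigr => i _ /=.
rewrite !mulr_sumr -big_split; apply: eq_bigr => j _ /=.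
by rewrite -cosB; congr cos; rewrite /A; ring.
Qed.

(** The square of sin (pi t), in the form whose mean against a trigonometric kernel
    is explicit. *)
Definition hav t : R := (1 - cos (2 * pi * t)) / 2.

(** In the double sum the samples annihilate all terms except the n diagonal ones;
    [n <= M] keeps the frequencies below M. *)
Lemma mean_fejer (n M : nat) x : (0 < n <= M)%N ->
  \sum_(0 <= a < M) fejer n (x - a%:R / M%:R) = M%:R.
Proof.
move=> /andP[n0 nM]; rewrite /fejer -mulr_sumr exchange_big /=.
rewrite (eq_bigr (fun i : 'I_n => M%:R)); last first.
  move=> i _; rewrite exchange_big /= (bigD1 i)//= [X in _ + X]big1 ?addr0.
    rewrite subrr.
    by have := @mean_cos_samples M 0 x (leq_trans n0 nM) (leq_trans n0 nM); rewrite mulr1.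
  move=> j ji.
  have := @mean_cos_samples M (i%:Z - j%:Z) x (leq_trans n0 nM).
  rewrite subr_eq0 eqz_nat eq_sym (negbTE (_ : val j != i)) ?val_eqE// mulr0 intrB => ->//.
  have := ltn_ord i; have := ltn_ord j; lia.
rewrite sumr_const card_ord -[M%:R *+ n]mulr_natl mulKf//.
by rewrite pnatr_eq0 -lt0n.
Qed.

(** Multiplication by the cosine shifts the frequencies i - j by one, so the samples
    keep the 2 (n - 1) pairs of neighbours, each with weight 1/2. *)
Lemma mean_fejer_cos (n M : nat) x : (0 < n < M)%N ->
  \sum_(0 <= a < M) cos (2 * pi * (x - a%:R / M%:R)) * fejer n (x - a%:R / M%:R) =
  M%:R * (1 - n%:R^-1).
Proof.
move=> /andP[n0 nM]; have M0 : (0 < M)%N by exact: leq_trans nM.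
pose c (d : int) (a : nat) : R := cos (2 * pi * d%:~R * (x - a%:R / M%:R)).
have E a : cos (2 * pi * (x - a%:R / M%:R)) * fejer n (x - a%:R / M%:R) =
    n%:R^-1 * \sum_(i < n) \sum_(j < n)
      2^-1 * (c (i%:Z - j%:Z + 1) a + c (i%:Z - j%:Z - 1) a).
  rewrite /fejer mulrCA; congr (_ * _); rewrite mulr_sumr; apply: eq_bigr => i _.
  rewrite mulr_sumr; apply: eq_bigr => j _; rewrite /c.
  set u := x - _.
  have -> : 2 * pi * (i%:Z - j%:Z + 1)%:~R * u = 2 * pi * (i%:R - j%:R) * u + 2 * pi * u.
    by rewrite intrD intrB -!pmulrn; ring.
  have -> : 2 * pi * (i%:Z - j%:Z - 1)%:~R * u = 2 * pi * (i%:R - j%:R) * u - 2 * pi * u.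
    by rewrite !intrB -!pmulrn; ring.
  by rewrite cosD cosB; field.
rewrite (eq_bigr _ (fun a _ => E a)) -mulr_sumr exchange_big /=.
have S (i j : 'I_n) : \sum_(0 <= a < M) 2^-1 * (c (i%:Z - j%:Z + 1) a + c (i%:Z - j%:Z - 1) a)
    = M%:R / 2 * ((j == i.+1 :> nat)%:R + (i == j.+1 :> nat)%:R).
  rewrite -mulr_sumr big_split /= /c !mean_cos_samples//; last first.
  - have := ltn_ord i; have := ltn_ord j; lia.
  - have := ltn_ord i; have := ltn_ord j; lia.
  rewrite (_ : (i%:Z - j%:Z + 1 == 0) = (j == i.+1 :> nat)); last by apply/idP/idP; lia.
  rewrite (_ : (i%:Z - j%:Z - 1 == 0) = (i == j.+1 :> nat)); last by apply/idP/idP; lia.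
  by field.
have C (i : 'I_n) : \sum_(j < n) (j == i.+1 :> nat)%:R = (i.+1 < n)%:R :> R.
  have [lt_in|ge_in] := ltnP i.+1 n.
    rewrite (bigD1 (Ordinal lt_in))//= eqxx big1 ?addr0// => j.
    by rewrite -val_eqE /= => /negbTE ->.
  by rewrite big1// => j _; rewrite (_ : (_ == _) = false)//; have := ltn_ord j; lia.
have D : \sum_(i < n) (i.+1 < n)%:R = n%:R - 1 :> R.
  case: n n0 {nM E S C} => // n _; rewrite big_ord_recr /= ltnn addr0.
  rewrite (eq_bigr (fun=> 1)); last by move=> i _; rewrite ltnS ltn_ord.
  by rewrite sumr_const card_ord -natr1 addrK.
under eq_bigr do (rewrite exchange_big /=; under eq_bigr do rewrite S).
rewrite (eq_bigr (fun i : 'I_n => M%:R / 2 * (\sum_(j < n) (j == i.+1 :> nat)%:R +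
   \sum_(j < n) (i == j.+1 :> nat)%:R))); last first.
  by move=> i _; rewrite -mulr_sumr big_split.
rewrite -mulr_sumr big_split /= [X in _ + X]exchange_big /=.
rewrite !(eq_bigr _ (fun i _ => C i)) D.
by field; rewrite pnatr_eq0 -lt0n.
Qed.

Lemma mean_fejer_hav (n M : nat) x : (0 < n < M)%N ->
  \sum_(0 <= a < M) hav (x - a%:R / M%:R) * fejer n (x - a%:R / M%:R) =
  M%:R * (2 * n%:R)^-1.
Proof.
move=> nM; rewrite (eq_bigr (fun a => 2^-1 * (fejer n (x - a%:R / M%:R) -
  cos (2 * pi * (x - a%:R / M%:R)) * fejer n (x - a%:R / M%:R)))); last first.
  by move=> a _; rewrite /hav; field.
rewrite -mulr_sumr sumrB mean_fejer ?mean_fejer_cos//; last first.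
  by case/andP: nM => -> /ltnW ->.
by field; rewrite pnatr_eq0 -lt0n; case/andP: nM.
Qed.

End Fejer.

(** * Uniform approximation by trigonometric polynomials *)

Section Approximation.
Context {R : realType}.
Implicit Types (f u v : R * R -> R) (k : int * int).

Definition trigpoly (s : seq (R * (int * int))) (p : R * R) : R :=
  \sum_(a <- s) a.1 * hartley a.2 p.

Definition is_trigpoly u := exists s, u = trigpoly s.

Lemma is_trigpoly_eq u v : is_trigpoly u -> u =1 v -> is_trigpoly v.
Proof. by move=> us /funext <-. Qed.

Lemma is_trigpolyD u v : is_trigpoly u -> is_trigpoly v -> is_trigpoly (fun p => u p + v p).
Proof.
move=> [s ->] [t ->]; exists (s ++ t); apply/funext => p.
by rewrite /trigpoly big_cat.
Qed.

Lemma is_trigpolyZ c u : is_trigpoly u -> is_trigpoly (fun p => c * u p).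
Proof.
move=> [s ->]; exists [seq (c * a.1, a.2) | a <- s]; apply/funext => p.
by rewrite /trigpoly big_map mulr_sumr; apply: eq_bigr => a _; rewrite mulrA.
Qed.

Lemma is_trigpoly_sum (I : Type) (r : seq I) (F : I -> R * R -> R) :
  (forall i, is_trigpoly (F i)) -> is_trigpoly (fun p => \sum_(i <- r) F i p).
Proof.
move=> tF; elim: r => [|i r ih].
  by exists [::]; apply/funext => p; rewrite /trigpoly !big_nil.
by apply: is_trigpoly_eq (is_trigpolyD (tF i) ih) _ => p; rewrite big_cons.
Qed.

Lemma is_trigpoly_cos k c :
  is_trigpoly (fun p => cos (2 * pi * (k.1%:~R * p.1 + k.2%:~R * p.2) + c)).
Proof.
exists [:: ((cos c - sin c) / 2, k); ((cos c + sin c) / 2, - k)].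
apply/funext => p; rewrite /trigpoly !big_cons big_nil /hartley /= !mulrNz.
set t := 2 * pi * (k.1%:~R * p.1 + k.2%:~R * p.2).
rewrite (_ : 2 * pi * _ = - t); last by rewrite /t; ring.
by rewrite /cas cosD cosN sinN; field.
Qed.

Lemma is_trigpoly_cos2 (m n : int) a b :
  is_trigpoly (fun p => cos (2 * pi * m%:~R * (p.1 - a)) * cos (2 * pi * n%:~R * (p.2 - b))).
Proof.
have H := is_trigpolyZ 2^-1 (is_trigpolyD
  (is_trigpoly_cos (m, n) (- (2 * pi * (m%:~R * a + n%:~R * b))))
  (is_trigpoly_cos (m, - n) (- (2 * pi * (m%:~R * a - n%:~R * b))))).
apply: is_trigpoly_eq H _ => p /=.
set A := 2 * pi * m%:~R * (p.1 - a); set B := 2 * pi * n%:~R * (p.2 - b).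
rewrite mulrNz.
rewrite (_ : 2 * pi * (m%:~R * p.1 + n%:~R * p.2) - _ = A + B); last by rewrite /A /B; ring.
rewrite (_ : 2 * pi * (m%:~R * p.1 + - n%:~R * p.2) - _ = A - B); last by rewrite /A /B; ring.
by rewrite cosB cosD; field.
Qed.

Lemma is_trigpoly_fejer (n : nat) a b :
  is_trigpoly (fun p => fejer n (p.1 - a) * fejer n (p.2 - b)).
Proof.
have H := @is_trigpoly_sum _ (index_enum 'I_n) _ (fun i1 =>
  @is_trigpoly_sum _ (index_enum 'I_n) _ (fun j1 =>
  @is_trigpoly_sum _ (index_enum 'I_n) _ (fun i2 =>
  @is_trigpoly_sum _ (index_enum 'I_n) _ (fun j2 =>
  is_trigpolyZ (n%:R^-1 * n%:R^-1) (is_trigpoly_cos2 (i1%:Z - j1%:Z) (i2%:Z - j2%:Z) a b))))).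
apply: is_trigpoly_eq H _ => p; rewrite /fejer mulrACA mulr_suml mulr_sumr.
apply: eq_bigr => i1 _; rewrite mulr_suml mulr_sumr; apply: eq_bigr => j1 _.
rewrite !mulr_sumr; apply: eq_bigr => i2 _; rewrite !mulr_sumr; apply: eq_bigr => j2 _.
by rewrite !intrB -!pmulrn.
Qed.

Lemma lipschitz1 (g : R -> R) (L : R) : (forall x, derivable g x 1) ->
  (forall x, `|g^`()%classic x| <= L) -> forall x y, `|g x - g y| <= L * `|x - y|.
Proof.
move=> dg gL; have H x y : x <= y -> `|g y - g x| <= L * `|y - x|.
  move=> xy; have [||c _ ->] := @MVT_segment R g g^`()%classic x y xy.
  - move=> z _; by rewrite derive1E; exact: derivableP (dg z).
  - apply: continuous_subspaceT => z.
    by apply: differentiable_continuous; apply/derivable1_diffP.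
  - by rewrite normrM ler_wpM2r.
move=> x y; have [xy|/ltW yx] := leP x y; last exact: H.
by rewrite distrC (distrC x); exact: H.
Qed.

Lemma smooth_lipschitz f : smooth_torus f -> exists2 L : R, 0 < L &
  forall x y s t, `|f (s, t) - f (x, y)| <= L * (`|s - x| + `|t - y|).
Proof.
move=> sf; have tb i : exists2 M : R, 0 < M & forall p, `|partial i f p| <= M.
  apply: torus_fun_bounded; first by apply: torus_partial; case: sf.
  by apply: smooth_continuous; exact: smooth_partial.
have [L0 L00 H0] := tb 0; have [L1 L10 H1] := tb 1.
exists (L0 + L1) => [|x y s t]; first exact: addr_gt0.
have A : `|f (s, t) - f (x, t)| <= L0 * `|s - x|.
  apply: (@lipschitz1 (fun s => f (s, t))) => z.
    by rewrite -slice0; exact: smooth_derivable.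
  by rewrite -partial0E.
have B : `|f (x, t) - f (x, y)| <= L1 * `|t - y|.
  apply: (@lipschitz1 (fun t => f (x, t))) => z.
    by rewrite -slice1; exact: smooth_derivable.
  by rewrite -partial1E.
rewrite -(subrKA (f (x, t))) (le_trans (ler_normD _ _))//.
have := normr_ge0 (s - x); have := normr_ge0 (t - y); nra.
Qed.

(** On [0, x / 2] the cosine is at least 1/2; apply the mean value theorem there and
    double the angle. *)
Lemma sin_ge_quarter (x : R) : 0 <= x <= pi / 2 -> x / 4 <= sin x.
Proof.
move=> /andP[x0 x2]; have hx : 0 <= x / 2 by lra.
have cosge z : 0 <= z <= x / 2 -> 2^-1 <= cos z.
  move=> /andP[z0 zx]; have p2 := @pi_ge2 R.
  have : 0 <= cos (z + z) by apply: cos_ge0_pihalf; apply/andP; split; lra.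
  have : 0 <= cos z by apply: cos_ge0_pihalf; apply/andP; split; lra.
  have := cos2Dsin2 z; rewrite cosD; nra.
have [|c] := @MVT_segment R sin cos 0 (x / 2) hx.
  by apply: continuous_subspaceT => z; exact: continuous_sin.
rewrite in_itv /= sin0 !subr0 => cI sE.
have h1 := cosge _ cI; have h2 := cosge (x / 2) ltac:(by rewrite hx lexx).
have hh : 4^-1 <= cos c * cos (x / 2) by nra.
have -> : sin x = cos c * cos (x / 2) * x.
  by rewrite {1}(splitr x) sinD sE; field.
by nra.
Qed.

Lemma sqr_le_hav (t : R) : `|t| <= 2^-1 -> t ^+ 2 <= 4 * hav t.
Proof.
move=> t2; have p2 := @pi_ge2 R.
have E : hav t = sin (pi * `|t|) ^+ 2.
  rewrite /hav (_ : cos _ = cos (pi * `|t| + pi * `|t|)).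
    have := cos2Dsin2 (pi * `|t|); rewrite cosD; nra.
  have [t0|t0] := ger0P t; first by congr cos; ring.
  by rewrite -cosN; congr cos; ring.
have t0 := normr_ge0 t.
have := @sin_ge_quarter (pi * `|t|) ltac:(apply/andP; split; nra).
rewrite E -(real_normK (num_real t)); move: `|t| t2 t0 => a t2 t0 H.
have : a / 2 <= sin (pi * a) by apply: le_trans H; nra.
by move=> H2; nra.
Qed.

Lemma hav_int t (n : int) : hav (t + n%:~R) = hav t :> R.
Proof. by rewrite /hav mulrDr cos_int. Qed.

(** The Korovkin test inequality: the modulus of continuity of [f] is dominated by
    the function [hav], on which the means of the Fejer kernel are explicit. Periodicity reduces the distances to at most 1/2, where d^2 is at
    most 4 hav d, and L d <= e / 2 + (2 L^2 / e) (d^2 / 4) absorbs the linear term. *)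
Lemma korovkin f e : smooth_torus f -> 0 < e -> exists2 C : R, 0 < C &
  forall x y s t, `|f (s, t) - f (x, y)| <= e + C * (hav (x - s) + hav (y - t)).
Proof.
move=> sf e0; have [L L0 HL] := smooth_lipschitz sf.
exists (2 * L ^+ 2 / e) => [|x y s t]; first by rewrite divr_gt0// mulr_gt0// exprn_gt0.
have R1 (z : R) : exists n : int, `|z - n%:~R| <= 2^-1.
  exists (Num.floor (z + 2^-1)); have := floor_itv (z + 2^-1).
  by rewrite intrD => /andP[? ?]; rewrite ler_norml; apply/andP; split; lra.
have [m Hm] := R1 (x - s); have [n Hn] := R1 (y - t).
have key (d : R) : `|d| <= 2^-1 -> L * `|d| <= e / 2 + 2 * L ^+ 2 / e * hav d.
  move=> d2; have := sqr_le_hav d2; rewrite -(real_normK (num_real d)).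
  have : 0 <= (e - L * `|d|) ^+ 2 := sqr_ge0 _.
  move=> h1 h2; rewrite -(ler_pM2r e0) mulrDl (_ : 2 * L ^+ 2 / e * hav d * e = 2 * L ^+ 2 * hav d).
    by nra.
  by field; rewrite gt_eqF.
rewrite -(torus_fun_int m n s t sf.1) (le_trans (HL _ _ _ _))//.
have -> : `|s + m%:~R - x| = `|x - s - m%:~R| by rewrite -normrN; congr Num.norm; ring.
have -> : `|t + n%:~R - y| = `|y - t - n%:~R| by rewrite -normrN; congr Num.norm; ring.
have := key _ Hm; have := key _ Hn.
have hI (z : R) (j : int) : hav (z - j%:~R) = hav z by rewrite -mulrNz hav_int.
rewrite !hI; lra.
Qed.

(** The approximant is the convolution of [f] with the product Fejer kernel, with a
    mean over an M by M grid in place of the integral: for M = n + 1 the grid already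
    has the exact means of the kernel, so no error of discretisation arises. *)
Lemma trigpoly_dense f e : smooth_torus f -> 0 < e ->
  exists s, forall p, `|f p - trigpoly s p| <= e.
Proof.
move=> sf e0; have [C C0 HC] := korovkin sf (divr_gt0 e0 (ltr0n _ 2)).
have [n n0 Cn] : exists2 n : nat, (0 < n)%N & C / n%:R <= e / 2.
  exists (Num.truncn (2 * C / e)).+1 => //.
  have := truncnS_gt (2 * C / e); set N : R := _.+1%:R => H.
  have N0 : 0 < N by rewrite ltr0n.
  by move: H; rewrite ltr_pdivrMr// ler_pdivrMr//; nra.
pose M := n.+1; have M0 : M%:R != 0 :> R by rewrite pnatr_eq0.
pose G a b (p : R * R) : R := fejer n (p.1 - a%:R / M%:R) * fejer n (p.2 - b%:R / M%:R).
pose T p := \sum_(0 <= a < M) \sum_(0 <= b < M)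
  (M%:R ^- 2 * f (a%:R / M%:R, b%:R / M%:R)) * G a b p.
have [s sT] : is_trigpoly T.
  apply: is_trigpoly_sum => a; apply: is_trigpoly_sum => b; apply: is_trigpolyZ.
  exact: is_trigpoly_fejer.
exists s => -[x y]; rewrite -sT distrC.
have G1 : \sum_(0 <= a < M) \sum_(0 <= b < M) M%:R ^- 2 * G a b (x, y) = 1.
  under eq_bigr do under eq_bigr do rewrite /G /= mulrA.
  under eq_bigr do rewrite -mulr_sumr mean_fejer ?n0 ?leqnSn//.
  by rewrite -mulr_suml -mulr_sumr mean_fejer ?n0 ?leqnSn//; field.
have -> : T (x, y) - f (x, y) = \sum_(0 <= a < M) \sum_(0 <= b < M)
    (f (a%:R / M%:R, b%:R / M%:R) - f (x, y)) * (M%:R ^- 2 * G a b (x, y)).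
  rewrite -{1}(mulr1 (f (x, y))) -[X in _ * X]G1 mulr_sumr /T -sumrB.
  apply: eq_bigr => a _.
  by rewrite mulr_sumr -sumrB; apply: eq_bigr => b _; ring.
have G0 a b : 0 <= M%:R ^- 2 * G a b (x, y).
  by rewrite mulr_ge0 ?invr_ge0 ?exprn_ge0 ?ler0n// mulr_ge0 ?fejer_ge0.
apply: (@le_trans _ _ (\sum_(0 <= a < M) \sum_(0 <= b < M)
   (e / 2 + C * (hav (x - a%:R / M%:R) + hav (y - b%:R / M%:R))) * (M%:R ^- 2 * G a b (x, y)))).
  rewrite (le_trans (ler_norm_sum _ _ _))// ler_sum// => a _.
  rewrite (le_trans (ler_norm_sum _ _ _))// ler_sum// => b _.
  by rewrite normrM (ger0_norm (G0 a b)) ler_wpM2r.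
rewrite (_ : \sum_(0 <= a < M) _ = e / 2 + C / n%:R); first by lra.
under eq_bigr => a _ do (under eq_bigr => b _ do rewrite mulrDl; rewrite big_split /= -mulr_sumr).
rewrite big_split /= -mulr_sumr G1 mulr1; congr (_ + _).
pose ha a := hav (x - a%:R / M%:R) * fejer n (x - a%:R / M%:R).
pose hb b := hav (y - b%:R / M%:R) * fejer n (y - b%:R / M%:R).
pose ka a := fejer n (x - a%:R / M%:R); pose kb b := fejer n (y - b%:R / M%:R).
have E a b : C * (hav (x - a%:R / M%:R) + hav (y - b%:R / M%:R)) * (M%:R ^- 2 * G a b (x, y)) =
    C * M%:R ^- 2 * (ha a * kb b + ka a * hb b).
  by rewrite /G /ha /hb /ka /kb /=; ring.
have Ska : \sum_(0 <= a < M) ka a = M%:R by apply: mean_fejer; rewrite n0 leqnSn.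
have Skb : \sum_(0 <= b < M) kb b = M%:R by apply: mean_fejer; rewrite n0 leqnSn.
have Sha : \sum_(0 <= a < M) ha a = M%:R * (2 * n%:R)^-1.
  by apply: mean_fejer_hav; rewrite n0 ltnSn.
have Shb : \sum_(0 <= b < M) hb b = M%:R * (2 * n%:R)^-1.
  by apply: mean_fejer_hav; rewrite n0 ltnSn.
clearbody ha hb ka kb.
under eq_bigr => a _ do (under eq_bigr => b _ do rewrite E; rewrite -mulr_sumr big_split /= -!mulr_sumr).
rewrite -mulr_sumr big_split /= -!mulr_suml Ska Skb Sha Shb.
by field; rewrite M0 pnatr_eq0 -lt0n n0.
Qed.

End Approximation.

(** * Null sets of periodic functions *)

Section PeriodicNull.
Context {R : realType}.
Implicit Types (u : R * R -> R).
Local Notation M1 := (measurableTypeR R).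
Local Notation T2 := (measurableTypeR R * measurableTypeR R)%type.
Local Notation S := (@unit_square R).
Local Notation mu := (plane_measure R).
Local Notation leb := (@lebesgue_measure R).

Lemma measurable_shift (c : R) : measurable_fun [set: M1] (fun x : M1 => (x + c : M1)).
Proof. by apply: measurable_funD => //; exact: measurable_cst. Qed.

(** The pushforward of the measure gives the same value to half-open intervals. *)
Lemma lebesgue_measure_shift (c : R) (A : set M1) : measurable A ->
  leb [set x | A (x + c)] = leb A.
Proof.
move=> mA; pose nu : {measure set M1 -> \bar R} :=
  measure_function_pushforward__canonical__measure_function_Measure leb (@measurable_shift c).
rewrite -[LHS]/(nu A); apply/esym; apply: lebesgue_measure_unique => // X [[a b] /= _ <-].
rewrite /nu /= /pushforward lebesgue_measure_itv.
have -> : (fun x : M1 => x + c) @^-1` [set` `]a, b]] = [set` `]a - c, b - c]].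
  by apply/seteqP; split => x /=; rewrite !in_itv /= => /andP[? ?]; apply/andP; split; lra.
rewrite lebesgue_measure_itv /= !lte_fin ltrD2r; case: ifPn => // _.
by rewrite -!EFinD; congr EFin; ring.
Qed.

Lemma measurable_shift2 (c : R * R) :
  measurable_fun [set: T2] (fun p : T2 => ((p.1 + c.1, p.2 + c.2) : T2)).
Proof.
apply: measurable_fun_pair => /=.
  exact: (measurableT_comp (@measurable_shift c.1) measurable_fst).
exact: (measurableT_comp (@measurable_shift c.2) measurable_snd).
Qed.

(** The product measure is determined by its values on rectangles. *)
Lemma plane_measure_shift (c : R * R) (A : set T2) : measurable A ->
  mu [set p | A (p.1 + c.1, p.2 + c.2)] = mu A.
Proof.
move=> mA; pose nu : {measure set T2 -> \bar R} :=
  measure_function_pushforward__canonical__measure_function_Measure mu (@measurable_shift2 c).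
rewrite -[LHS]/(nu A); apply/esym; apply: product_measure_unique => // X Y mX mY.
rewrite -[LHS]/(mu ([set x | X (x + c.1)] `*` [set y | Y (y + c.2)])).
rewrite -[LHS]/((leb \x leb)%E _) product_measure1E.
- by congr (_ * _)%E; exact: lebesgue_measure_shift.
- by rewrite -[X in measurable X]setTI; exact: measurable_shift.
- by rewrite -[X in measurable X]setTI; exact: measurable_shift.
Qed.

(** The plane is a countable union of integral translates of the unit square. *)
Lemma ae_zero_torus u : torus_fun u -> measurable_fun [set: T2] u ->
  {ae mu, forall p, S p -> u p = 0} -> ae_zero u.
Proof.
move=> tu mu_ /= uS.
pose A : set T2 := S `&` [set p | u p != 0].
have mA : measurable A.
  apply: measurableI; first exact: measurable_unit_square.
  rewrite (_ : [set p | _] = u @^-1` [set~ 0]).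
    by rewrite -[X in measurable X]setTI; apply: mu_ => //; exact: measurableC.
  by apply/seteqP; split => p /= /eqP.
have A0 : mu A = 0%E.
  apply: (negligibleP mu mA).1; apply: negligibleS uS => p [/= Sp /eqP up] /(_ Sp).
  exact: up.
pose B (c : int * int) : set T2 := [set p | A (p.1 + c.1%:~R, p.2 + c.2%:~R)].
have B0 c : mu.-negligible (B c).
  have mB : measurable (B c).
    by rewrite -[X in measurable X]setTI; exact: (@measurable_shift2 (c.1%:~R, c.2%:~R)).
  apply: (negligibleP mu mB).2.
  by have := plane_measure_shift (c.1%:~R, c.2%:~R) mA; rewrite A0.
have H : mu.-negligible (\bigcup_n if unpickle n is Some c then B c else set0).
  apply: negligible_bigcup => n.
  by case: unpickle => [c|]; [exact: B0|exact: negligible_set0].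
apply: negligibleS H => -[x y] /= /eqP uxy.
(* The code of [c] is never evaluated if [c] is opaque. *)
have [c cE] : exists c, c = (- Num.floor x, - Num.floor y) by exists (- Num.floor x, - Num.floor y).
exists (pickle c); first exact: I.
rewrite pickleK cE {c cE}.
have := floor_itv x; have := floor_itv y; rewrite !intrD => /andP[? ?] /andP[? ?].
split => /=; last by rewrite torus_fun_int.
by split; rewrite /= in_itv /= mulrNz; apply/andP; split; lra.
Qed.

End PeriodicNull.

(** * Eigenfunctions and multiplicities *)

Section Spectrum.
Context {R : realType} (alpha h : R).
Context (h0 : 0 < h).
Implicit Types (u v f : R * R -> R) (k : int * int).
Local Notation T2 := (measurableTypeR R * measurableTypeR R)%type.
Local Notation S := (@unit_square R).
Local Notation mu := (plane_measure R).
Local Notation ip := (inner mu (S : set T2)).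
Local Notation sqi := (sqint mu (S : set T2)).
Local Notation G := (g_ alpha h).
Local Notation lam := (eigval alpha h).
Let mS : measurable (S : set T2) := @measurable_unit_square R.
Let sh k : sqi (hartley k) := @sqint_hartley R k.

Let ae_filter : Filter (almost_everywhere mu).
Proof. exact: ae_filter_ringOfSetsType. Qed.

Let bessel_hartley w k : sqi w -> ip w (hartley k) ^+ 2 <= ip w w.
Proof. by move=> sw; apply: (bessel1 mS) => //; rewrite ip_hartley eqxx. Qed.

Lemma L2sqE u : sqi u -> L2sq G u = (h^-1 * ip u u)%:E.
Proof.
move=> su; rewrite /L2sq EFinM -(integral_sq mS su) -integralZl//; last exact: su.2.
apply: eq_integral => p _; by rewrite vol_density_g// -EFinM mulrC.
Qed.

Lemma sqint_L2_torus u : L2_torus G u -> sqi u.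
Proof.
move=> [_ mu_ fu]; split=> //.
have i1 : mu.-integrable (S : set T2) (EFin \o (fun p => u p ^+ 2 * h^-1)).
  apply/integrableP; split.
    apply/measurable_EFinP; apply: measurable_funTS.
    by apply: measurable_funM => //; exact: measurable_funX.
  apply: le_lt_trans fu; rewrite /L2sq le_eqVlt; apply/orP; left; apply/eqP.
  apply: eq_integral => p _ /=.
  by rewrite vol_density_g// ger0_norm// mulr_ge0 ?sqr_ge0 ?invr_ge0// ltW.
rewrite (_ : _ \o _ = (fun p => h%:E * (u p ^+ 2 * h^-1)%:E)%E).
  exact: (integrableZl mS _ i1).
by apply/funext => p /=; rewrite -EFinM; congr EFin; field; rewrite gt_eqF.
Qed.

Lemma sqint_laplace f : smooth_torus f -> sqi (laplace_beltrami G f).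
Proof.
move=> sf.
have -> : laplace_beltrami G f = fun p => -1 *
    \sum_(i < 2) \sum_(j < 2) cometric alpha h i j * partial i (partial j f) p.
  apply/funext => p; rewrite laplace_beltrami_g// ?mulN1r//.
  by move=> i j; apply: smooth_derivable; exact: smooth_partial.
apply: (sqintZ mS); do 2 apply: (sqint_sum mS) => ?; apply: (sqintZ mS).
by apply: sqint_smooth; do 2 apply: smooth_partial.
Qed.

(** The two convergences at one common index, freed from extended reals and from the
    density of the volume. *)
Lemma graph_approx u v e : laplacian_graph G u v -> 0 < e ->
  exists f, [/\ smooth_torus f, ip (fun p => f p - u p) (fun p => f p - u p) <= e &
    ip (fun p => laplace_beltrami G f p - v p)
       (fun p => laplace_beltrami G f p - v p) <= e].
Proof.
move=> [/sqint_L2_torus su /sqint_L2_torus sv [phi [sphi c1 c2]]] e0.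
have H (w : nat -> R * R -> R) : (forall n, sqi (w n)) ->
    (fun n => L2sq G (w n)) @ \oo --> 0%E -> \forall n \near \oo, ip (w n) (w n) <= e.
  move=> sw /fine_cvgP[_] /cvgr0Pnorm_le /(_ (h^-1 * e)).
  rewrite mulr_gt0 ?invr_gt0// => /(_ isT); apply: filterS => n /=.
  rewrite L2sqE//= ger0_norm ?mulr_ge0 ?invr_ge0 ?(ltW h0) ?ip_ge0//.
  by rewrite ler_pM2l// invr_gt0.
have c1' := H _ (fun n => sqintB mS (sqint_smooth (sphi n)) su) c1.
have c2' := H _ (fun n => sqintB mS (sqint_laplace (sphi n)) sv) c2.
have [n [A B]] := filter_ex (filterI c1' c2').
by exists (phi n); split.
Qed.

Lemma eigenfunction_sqint m u : eigenfunction G m u -> sqi u.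
Proof. by move=> [/sqint_L2_torus]. Qed.

(** A limit of smooth functions inherits Green's formula, so an eigenfunction
    is orthogonal to the Hartley functions of the other eigenvalues. *)
Lemma eigenfunction_orthogonal m u k :
  eigenfunction G m u -> lam k != m -> ip u (hartley k) = 0.
Proof.
move=> Eu lm; have su := eigenfunction_sqint Eu.
have sv := sqintZ mS m su.
set c := ip u (hartley k).
suff X0 : ((lam k - m) * c) ^+ 2 <= 0.
  have /eqP : ((lam k - m) * c) ^+ 2 = 0.
    by apply/eqP; rewrite eq_le X0 sqr_ge0.
  by rewrite sqrf_eq0 mulf_eq0 subr_eq0 (negbTE lm) => /eqP.
have p0 : 0 < 2 * (lam k ^+ 2 + 1) by rewrite mulr_gt0// ltr_pwDr// sqr_ge0.
apply/ler_addgt0Pr => e e0; rewrite add0r.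
have [f [sf F1 F2]] := graph_approx Eu (divr_gt0 e0 p0).
have sfi := sqint_smooth sf; have sL := sqint_laplace sf.
have B1 := bessel_hartley k (sqintB mS sfi su).
have B2 := bessel_hartley k (sqintB mS sL sv).
move: (le_trans B1 F1) (le_trans B2 F2).
rewrite !(ipBl mS)// (ipZl mS)// ip_laplace// -/c.
set a := ip f _; set L := lam k.
set d := e / _ => {}B1 {}B2.
have -> : e = 2 * (L ^+ 2 + 1) * d by rewrite /d mulrC divfK// gt_eqF.
have -> : (L - m) * c = (L * a - m * c) - L * (a - c) by ring.
have := sqr_ge0 (L * a - m * c + L * (a - c)).
have := sqr_ge0 L; nra.
Qed.

Lemma ip_trigpoly0 w s : sqi w -> (forall k, ip w (hartley k) = 0) ->
  ip w (trigpoly s) = 0.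
Proof.
move=> sw w0; rewrite ipC (ip_suml mS)//; last by move=> a; exact: (sqintZ mS).
by rewrite big1// => a _; rewrite (ipZl mS)// ipC w0 mulr0.
Qed.

Lemma sqint_trigpoly s : sqi (trigpoly s).
Proof. by apply: (sqint_sum mS) => a; exact: (sqintZ mS). Qed.

Lemma ip_bounded w e : sqi w -> (forall p, `|w p| <= e) -> ip w w <= e ^+ 2.
Proof.
move=> sw we.
rewrite (_ : e ^+ 2 = \int[mu]_(p in (S : set T2)) (e ^+ 2)); last first.
  by rewrite Rintegral_cst// plane_measure_unit_square mulr1.
apply: le_Rintegral => //; first exact: sqint_mul.
  apply: measurable_bounded_integrable => //.
    by rewrite plane_measure_unit_square ltry.
  exists (e ^+ 2); split; first exact: num_real.
  by move=> N eN p _ /=; rewrite ger0_norm ?sqr_ge0// ltW.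
move=> p _; rewrite -expr2 -(real_normK (num_real (w p))).
have := we p; have := normr_ge0 (w p); nra.
Qed.

(** Completeness of the Hartley system on L2-limits of smooth functions. The
    difference [w] is orthogonal to all trigonometric polynomials, so its norm is at
    most that of [u - T] for every trigonometric polynomial [T]; and [u] is close to
    a smooth function, which is uniformly close to some [T]. *)
Lemma graph_complete u v (K : seq (int * int)) : laplacian_graph G u v -> uniq K ->
  (forall k, k \notin K -> ip u (hartley k) = 0) ->
  ae_zero (fun p => u p - \sum_(k <- K) ip u (hartley k) * hartley k p).
Proof.
move=> Eu uK K0; have [Tu _ _] := Eu; have su := sqint_L2_torus Tu.
pose P := trigpoly [seq (ip u (hartley k), k) | k <- K].
have PE p : P p = \sum_(k <- K) ip u (hartley k) * hartley k p.
  by rewrite /P /trigpoly big_map.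
have sP : sqi P by exact: sqint_trigpoly.
pose w p := u p - P p; have sw : sqi w by exact: (sqintB mS).
rewrite (_ : (fun p => _) = w); last by apply/funext => p; rewrite /w PE.
have w0 l : ip w (hartley l) = 0.
  rewrite /w (ipBl mS)// /P (ip_suml mS)//; last by move=> a; exact: (sqintZ mS).
  rewrite big_map (eq_bigr (fun k => ip u (hartley k) * (k == l)%:R)); last first.
    by move=> k _; rewrite (ipZl mS)// ip_hartley.
  have [lK|lK] := boolP (l \in K); last first.
    rewrite K0// sub0r big_seq big1 ?oppr0// => k kK.
    by case: eqP kK => [->|]; rewrite ?(negbTE lK)// mulr0.
  rewrite (bigD1_seq l)//= eqxx mulr1 big1 ?addr0 ?subrr// => k /negbTE ->.
  by rewrite mulr0.
suff ww : ip w w = 0.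
  apply: ae_zero_torus.
  - move=> x y; have [tu _ _] := Tu; rewrite /w !PE (tu _ _).1 (tu _ _).2.
    split; congr (_ - _); apply: eq_bigr => k _.
      by rewrite (torus_hartley k _ _).1.
    by rewrite (torus_hartley k _ _).2.
  - exact: sw.1.
  - exact: (ip_eq0_ae mS sw ww).
apply/eqP; rewrite eq_le ip_ge0 andbT; apply/ler_addgt0Pr => e' e'0; rewrite add0r.
pose e := Num.min 1 (e' / 4).
have e0 : 0 < e by rewrite lt_min ltr01 divr_gt0.
have e1 : e <= 1 by rewrite ge_min lexx.
have e4 : e <= e' / 4 by rewrite ge_min lexx orbT.
have [f [sf F1 _]] := graph_approx Eu e0.
have [s Hs] := trigpoly_dense sf e0.
have sfi := sqint_smooth sf; have sT := sqint_trigpoly s.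
(* u - T is w minus a trigonometric polynomial, which is orthogonal to w. *)
have A1 : ip w w <= ip (fun p => u p - trigpoly s p) (fun p => u p - trigpoly s p).
  have -> : (fun p => u p - trigpoly s p) = (fun p : T2 => w p - (trigpoly s p - P p)).
    by apply/funext => p; rewrite /w; ring.
  have sTP := sqintB mS sT sP.
  have wTP : ip w (fun p => trigpoly s p - P p) = 0.
    rewrite ipC (ipBl mS sT sP sw).
    by rewrite !(ipC mu (S : set T2) _ w) !ip_trigpoly0// subr0.
  by rewrite (ipBB mS sw sTP) wTP mulr0 subr0 lerDl ip_ge0.
have A2 := ip_bounded (sqintB mS sfi sT) Hs.
have := ip_add_le mS (sqintB mS su sfi) (sqintB mS sfi sT).
rewrite (_ : (fun p => u p - f p + (f p - trigpoly s p)) = (fun p => u p - trigpoly s p)); last first.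
  by apply/funext => p; ring.
have -> : ip (fun p => u p - f p) (fun p => u p - f p) = ip (fun p => f p - u p) (fun p => f p - u p).
  by apply: eq_Rintegral => p _; ring.
by nra.
Qed.

Lemma eigenfunction_expansion m u (K : seq (int * int)) : eigenfunction G m u ->
  uniq K -> (forall k, lam k = m -> k \in K) ->
  ae_zero (fun p => u p - \sum_(k <- K) ip u (hartley k) * hartley k p).
Proof.
move=> Eu uK Km; apply: (graph_complete Eu uK) => k kK.
by apply: (eigenfunction_orthogonal Eu); apply: contra kK => /eqP /Km.
Qed.

(** The constant sequence is an admissible sequence of smooth approximations. *)
Lemma eigenfunction_hartley k : eigenfunction G (lam k) (hartley k).
Proof.
have TZ c : L2_torus G (fun p => c * hartley k p).
  have sc := sqintZ mS c (sh k); split; last by rewrite L2sqE// ltry.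
  - by move=> x y; rewrite (torus_hartley k _ _).1 (torus_hartley k _ _).2.
  - exact: sc.1.
have T0 : L2sq G (fun=> 0) = 0%E.
  rewrite L2sqE; last exact: sqint0.
  rewrite (_ : ip _ _ = 0) ?mulr0//; apply/eqP; rewrite eq_le ip_ge0 andbT.
  have := @ip_bounded (fun=> 0) 0 (sqint0 _ _); rewrite expr0n; apply.
  by move=> p; rewrite normr0.
split; [|exact: TZ|].
  by have := TZ 1; congr (L2_torus _ _); apply/funext => p; rewrite mul1r.
exists (fun=> hartley k); split; first by move=> _; exact: smooth_hartley.
- rewrite (_ : (fun n => _) = cst 0%E); first exact: cvg_cst.
  by apply/funext => n; rewrite -T0; congr L2sq; apply/funext => p /=; rewrite subrr.
- rewrite (_ : (fun n => _) = cst 0%E); first exact: cvg_cst.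
  apply/funext => n; rewrite -T0; congr L2sq; apply/funext => p /=.
  by rewrite laplace_hartley// subrr.
Qed.

Lemma ip_ae_zero u v : sqi u -> sqi v -> ae_zero u -> ip u v = 0.
Proof.
move=> su sv u0; rewrite /inner /Rintegral.
have -> : (\int[mu]_(p in (S : set T2)) (u p * v p)%:E = \int[mu]_(p in (S : set T2)) 0)%E.
  apply: ae_eq_integral => //.
  - exact: (measurable_int _ (sqint_mul mS su sv)).
  - have {}u0 : {ae mu, forall p, u p = 0} := u0.
    have H : {ae mu, forall p, S p -> (u p * v p)%:E = 0%E}.
      apply: (@filterS _ _ ae_filter _ _ _ u0) => p -> _.
      by rewrite mul0r.
    exact: H.
by rewrite integral0.
Qed.

Lemma hartley_free (K : seq (int * int)) : uniq K ->
  L2_free (fun i : 'I_(size K) => @hartley R (nth 0 K i)).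
Proof.
move=> uK c c0 i.
pose w p := \sum_(j < size K) c j * hartley (nth 0 K j) p.
have sc j : sqi (fun p => c j * hartley (nth 0 K j) p) by exact: (sqintZ mS).
have sw : sqi w by exact: (sqint_sum mS).
have := ip_ae_zero sw (sh (nth 0 K i)) c0.
rewrite /w (ip_suml mS)// (bigD1 i)//= (ipZl mS)// ip_hartley eqxx mulr1 big1 ?addr0//.
move=> j ji; rewrite (ipZl mS)// ip_hartley nth_uniq//.
by rewrite (negbTE (_ : val j != val i)) ?mulr0.
Qed.

(** n independent eigenfunctions have an n x (size K) coefficient matrix on the
    Hartley functions of K; if n > size K it has a nonzero left kernel. *)
Lemma L2_free_bound m n (u : 'I_n -> R * R -> R) (K : seq (int * int)) :
  uniq K -> (forall k, lam k = m -> k \in K) ->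
  (forall i, eigenfunction G m (u i)) -> L2_free u -> (n <= size K)%N.
Proof.
move=> uK Km Eu fu; rewrite leqNgt; apply/negP => ltn.
pose A : 'M[R]_(n, size K) := \matrix_(i, j) ip (u i) (hartley (nth 0 K j)).
have : kermx A != 0.
  rewrite -mxrank_eq0 mxrank_ker subn_eq0 -ltnNge.
  exact: leq_ltn_trans (rank_leq_col A) ltn.
move=> /matrix0Pn[i0 [j0 /eqP]]; apply.
pose c := row i0 (kermx A).
have cA : c *m A = 0 by rewrite /c -row_mul mulmx_ker row0.
suff H : {ae mu, forall p, \sum_(i < n) c 0 i * u i p = 0} by have := fu _ H j0; rewrite mxE.
have : {ae mu, forall p, forall i, u i p = \sum_(k <- K) ip (u i) (hartley k) * hartley k p}.
  apply: filter_forall => i.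
  have E : {ae mu, forall p, u i p - \sum_(k <- K) ip (u i) (hartley k) * hartley k p = 0} :=
    eigenfunction_expansion (Eu i) uK Km.
  move: E.
  by apply: (filterS (Filter := ae_filter)) => p /eqP; rewrite subr_eq0 => /eqP.
apply: (filterS (Filter := ae_filter)) => p Hp.
under eq_bigr => i _ do rewrite Hp (big_nth 0) big_mkord mulr_sumr.
rewrite exchange_big /= big1// => j _.
transitivity ((c *m A) 0 j * hartley (nth 0 K j) p); last by rewrite cA mxE mul0r.
rewrite mxE mulr_suml; apply: eq_bigr => i _.
by rewrite [A _ _]mxE mulrA.
Qed.

Lemma multiplicityE m (K : seq (int * int)) : uniq K ->
  (forall k, (k \in K) = (lam k == m)) -> multiplicity G m = (size K)%:R%:E.
Proof.
move=> uK Km; apply/eqP; rewrite eq_le; apply/andP; split.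
  apply: ge_ereal_sup => _ [n [u [Eu fu]] <-].
  rewrite lee_fin ler_nat; apply: (L2_free_bound uK _ Eu fu) => k km.
  by rewrite Km km.
apply: ereal_sup_ubound; exists (size K) => //.
exists (fun i : 'I_(size K) => hartley (nth 0 K i)); split; last exact: hartley_free.
move=> i; have := mem_nth 0 (ltn_ord i); rewrite Km => /eqP <-.
exact: eigenfunction_hartley.
Qed.

(** If no lattice point has the eigenvalue m, the expansion of an eigenfunction over
    the empty list says that it vanishes almost everywhere. *)
Lemma laplace_eigenvalueE m : laplace_eigenvalue G m <-> exists k, lam k = m.
Proof.
split=> [[u [Eu nu]]|[k <-]].
  apply: contrapT => H; apply: nu.
  have X k : lam k = m -> k \in [::] by move=> km; case: H; exists k.
  have E : {ae mu, forall p, u p - \sum_(k <- [::]) ip u (hartley k) * hartley k p = 0} :=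
    @eigenfunction_expansion m u [::] Eu isT X.
  have : {ae mu, forall p, u p = 0}; last by [].
  by move: E; apply: (filterS (Filter := ae_filter)) => p; rewrite big_nil subr0.
exists (hartley k); split; first exact: eigenfunction_hartley.
move=> k0; have := ip_ae_zero (sh k) (sh k) k0.
by rewrite ip_hartley eqxx => /eqP; rewrite oner_eq0.
Qed.

End Spectrum.

(** * The distribution function as a number of lattice points *)

Section LatticeCount.
Context {R : realType}.
Implicit Types (alpha h lambda : R) (k : int * int).

Lemma finite_int_le (B : R) : finite_set [set z : int | `|z%:~R : R| <= B].
Proof.
pose N := (Num.truncn B).+1.
apply: (@sub_finite_set _ _ ((fun i : nat => i%:Z - N%:Z) @` `I_(N + N).+1)); last first.
  by apply: finite_image; exact: finite_II.
move=> z /= zB; have BN : B < N%:R by exact: truncnS_gt.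
have : `|z| < N%:Z.
  by rewrite -(ltr_int R) intr_norm (le_lt_trans zB).
by move=> zN; exists (absz (z + N%:Z)) => /=; lia.
Qed.

(** For h <= 1 the form is at least h^2 times the one for h = 1, which is
    (1 + alpha^2) (m^2 + n^2). *)
Lemma finite_eigval alpha h lambda : 0 < h <= 1 ->
  finite_set [set k | eigval alpha h k <= lambda].
Proof.
move=> /andP[h0 h1]; have a0 : 0 < 1 + alpha ^+ 2 by rewrite ltr_pwDl// sqr_ge0.
pose D := lambda / (4 * pi ^+ 2 * h ^+ 2) + 1.
apply: (@sub_finite_set _ _ ([set z : int | `|z%:~R : R| <= D] `*` [set z : int | `|z%:~R : R| <= D])); last first.
  by apply: finite_setX; exact: finite_int_le.
move=> [m n]; rewrite /eigval /=; set x : R := m%:~R; set y : R := n%:~R => H.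
have p0 : 0 < 4 * pi ^+ 2 * h ^+ 2 :> R by rewrite !mulr_gt0 ?exprn_gt0 ?pi_gt0.
have xy : x ^+ 2 + y ^+ 2 <= lambda / (4 * pi ^+ 2 * h ^+ 2).
  rewrite ler_pdivlMr//; apply: le_trans H.
  have -> : (x ^+ 2 + y ^+ 2) * (4 * pi ^+ 2 * h ^+ 2) = 4 * pi ^+ 2 / (1 + alpha ^+ 2) *
      (h ^+ 2 * (x + alpha * y) ^+ 2 + h ^+ 2 * (y - alpha * x) ^+ 2).
    by field; rewrite gt_eqF.
  rewrite ler_pM2l; last by rewrite divr_gt0// mulr_gt0 ?exprn_gt0 ?pi_gt0.
  rewrite lerD2r ler_piMl ?sqr_ge0// expr_le1//; exact: ltW.
have sq (a : R) : `|a| <= a ^+ 2 + 1.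
  by rewrite -(real_normK (num_real a)); have := sqr_ge0 (`|a| - 1); nra.
split => /=; rewrite -/x -/y /D.
  by apply: le_trans (sq _) _; have := sqr_ge0 y; lra.
by apply: le_trans (sq _) _; have := sqr_ge0 x; lra.
Qed.

(** The sum over the eigenvalues of the numbers of lattice points at each of them
    counts every lattice point once. *)
Lemma N_lattice alpha h lambda : 0 < h <= 1 ->
  N_ alpha h lambda = (\esum_(k in [set k | (eigval alpha h k <= lambda)%R]) 1)%E.
Proof.
move=> h01; have /andP[h0 _] := h01.
rewrite /N_ /spectrum_distribution.
pose J m := [set k | eigval alpha h k = m].
have fJ m : finite_set (J m).
  by apply: sub_finite_set (finite_eigval alpha m h01) => k /= ->.
rewrite (eq_esum (b := fun m => \esum_(k in J m) 1%E)); last first.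
  move=> m _; rewrite (@multiplicityE _ _ _ h0 _ (finmap.enum_fset (fset_set (J m)))); last 2 first.
  - exact: finmap.fset_uniq.
  - move=> k; transitivity (k \in J m); first exact: (in_fset_set (fJ m) k).
    by apply/idP/eqP; rewrite inE.
  rewrite esum_fset// fsbig_finite//=.
  by rewrite -[in LHS]sum1_size natr_sum -sumEFin.
rewrite esum_esum//.
rewrite (@reindex_esum _ _ _ [set k | eigval alpha h k <= lambda] _
  (fun k => (eigval alpha h k, k)))//.
split.
- move=> k /= kl; split => //=; split => //.
  by apply/(laplace_eigenvalueE alpha h0); exists k.
- by move=> k l _ _ [].
- move=> [m k] [/= [_ ml] km]; rewrite /J /= in km.
  by exists k => /=; rewrite km.
Qed.

End LatticeCount.

(** * Lattice points of an ellipse, line by line *)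

Section BasisCount.
Context {R : realType}.

Lemma esum1_int_interval (f g : int) (n : nat) : f + g + 1 = n ->
  (\esum_(i in [set i : int | (- g <= i <= f)%R]) 1 = n%:R%:E :> \bar R)%E.
Proof.
move=> fgn; rewrite (@reindex_esum _ _ _ `I_n _ (fun k : nat => k%:Z - g))//; last first.
  split.
  - by move=> k /= kn; lia.
  - by move=> k l _ _ /=; lia.
  - by move=> i /= ig; exists (absz (i + g)) => /=; lia.
rewrite esum_fset; [|exact: finite_II|by []].
by rewrite -fsbig_ord sumEFin sumr_const card_ord.
Qed.

(** The integers lie in the interval from (- B - sqrt D) / A to (- B + sqrt D) / A,
    whose ends round to - g and f. *)
Lemma count_int_square (A B D : R) : 0 < A -> 0 <= D ->
  let c := (\esum_(i in [set i : int | ((A * i%:~R + B) ^+ 2 <= D)%R]) 1)%E in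
  c \is a fin_num /\ `|fine c - 2 * Num.sqrt D / A| <= 1.
Proof.
move=> A0 D0 c; pose s := Num.sqrt D; have s0 : 0 <= s by exact: sqrtr_ge0.
have sD : s ^+ 2 = D by exact: sqr_sqrtr.
pose f := Num.floor ((- B + s) / A); pose g := Num.floor ((B + s) / A).
have := floor_itv ((- B + s) / A); have := floor_itv ((B + s) / A).
rewrite -/f -/g !intrD => /andP[g1 g2] /andP[f1 f2].
have E : (- B + s) / A + (B + s) / A = 2 * s / A by field; rewrite gt_eqF.
have q0 : 0 <= 2 * s / A by rewrite divr_ge0 ?mulr_ge0// ltW.
have n0 : (-1 : int) < f + g + 1.
  by rewrite -(ltr_int R) !intrD mulrN1z; lra.
have cE : c = (absz (f + g + 1))%:R%:E.
  rewrite -(@esum1_int_interval f g); last by lia.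
  rewrite /c; congr esum; apply/seteqP; split => i /=.
    rewrite -sD => H; have : `|A * i%:~R + B| <= s.
      by rewrite -(@ler_pXn2r _ 2) ?nnegrE// real_normK ?num_real.
    rewrite ler_norml => /andP[H1 H2]; apply/andP; split.
      rewrite lerNl floor_ge_int_tmp ler_pdivlMr//.
      by rewrite mulrNz; lra.
    by rewrite floor_ge_int_tmp ler_pdivlMr//; lra.
  move=> /andP[]; rewrite lerNl !floor_ge_int_tmp !ler_pdivlMr// mulrNz -sD.
  move=> H1 H2; rewrite -(real_normK (num_real (A * i%:~R + B))).
  by rewrite ler_pXn2r ?nnegrE// ler_norml; apply/andP; split; lra.
rewrite cE; split => //=.
have -> : (absz (f + g + 1))%:R = f%:~R + g%:~R + 1 :> R.
  by rewrite -[1 in RHS]/(1%:~R) -!intrD pmulrn; congr (_%:~R); lia.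
rewrite -/s -E ler_norml; apply/andP; split; lra.
Qed.

Context (alpha h : R) (a b c d : int).
Context (h0 : 0 < h) (det1 : a * d - b * c = 1).

(** For the vector (a, b): its components along F and H, up to the common factor
    sqrt (1 + alpha^2). *)
Definition coordF : R := a%:~R + alpha * b%:~R.
Definition coordH : R := b%:~R - alpha * a%:~R.
Definition line_lead : R := coordF ^+ 2 + h ^+ 2 * coordH ^+ 2.
(** On the line of index j of a basis with first vector (a, b), the form minus L is a
    quadratic polynomial in the other coordinate, with leading coefficient [line_lead];
    this is a quarter of its discriminant. The second vector does not enter because
    the basis has determinant 1. *)
Definition line_disc (L : R) (j : int) : R :=
  line_lead * L - (h * (1 + alpha ^+ 2) * j%:~R) ^+ 2.

Lemma line_lead_gt0 : 0 < line_lead.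
Proof.
have a0 : 0 < 1 + alpha ^+ 2 by rewrite ltr_pwDl// sqr_ge0.
have t0 : 0 <= h ^+ 2 * coordH ^+ 2 by apply: mulr_ge0; exact: sqr_ge0.
have l0 : 0 <= line_lead by apply: addr_ge0 => //; exact: sqr_ge0.
rewrite lt_neqAle l0 andbT eq_sym; apply/eqP => /eqP; rewrite /line_lead paddr_eq0 ?sqr_ge0//.
rewrite sqrf_eq0 mulf_eq0 !sqrf_eq0 (gt_eqF h0)/= => /andP[/eqP s /eqP t].
have : (1 + alpha ^+ 2) * a%:~R = 0.
  by transitivity (coordF - alpha * coordH); [rewrite /coordF /coordH; ring|rewrite s t; ring].
have : (1 + alpha ^+ 2) * b%:~R = 0.
  by transitivity (coordH + alpha * coordF); [rewrite /coordF /coordH; ring|rewrite s t; ring].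
move=> /eqP; rewrite mulf_eq0 gt_eqF//= intr_eq0 => /eqP b0.
move=> /eqP; rewrite mulf_eq0 gt_eqF//= intr_eq0 => /eqP a00.
by move: det1; rewrite a00 b0 !mul0r subrr.
Qed.

Lemma finite_line_disc (L : R) : finite_set [set j | 0 <= line_disc L j].
Proof.
have a0 : 0 < h * (1 + alpha ^+ 2) by rewrite mulr_gt0// ltr_pwDl// sqr_ge0.
pose q := line_lead * L / (h * (1 + alpha ^+ 2)) ^+ 2.
apply: (sub_finite_set _ (finite_int_le (q + 1))) => j /=.
rewrite /line_disc subr_ge0 exprMn mulrC -ler_pdivlMr ?exprn_gt0// -/q => H.
have := sqr_ge0 (`|j%:~R| - 1 : R); rewrite -(real_normK (num_real _)) in H; nra.
Qed.

(** In a basis of Z^2 the lattice points of the ellipse lie on the lines j = const; 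
    completing the square counts them line by line, with an error at most one on
    each line. *)
Lemma lattice_count (L : R) : exists2 r : R,
  `|r| <= \sum_(j \in [set j : int | 0 <= line_disc L j]) (1 : R) &
  (\esum_(k in [set k : int * int |
      ((k.1%:~R + alpha * k.2%:~R) ^+ 2 + h ^+ 2 * (k.2%:~R - alpha * k.1%:~R) ^+ 2 <= L)%R]) 1)%E =
  (\sum_(j \in [set j : int | 0 <= line_disc L j]) 2 * Num.sqrt (line_disc L j) / line_lead + r)%:E.
Proof.
set J := [set j | _].
pose sw : R := c%:~R + alpha * d%:~R; pose tw : R := d%:~R - alpha * c%:~R.
pose B (j : int) : R := j%:~R * (coordF * sw + h ^+ 2 * (coordH * tw)).
pose I (j : int) := [set i : int | (line_lead * i%:~R + B j) ^+ 2 <= line_disc L j].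
pose e (x : int * int) : int * int := (x.2 * a + x.1 * c, x.2 * b + x.1 * d).
have lp := line_lead_gt0.
have detR : a%:~R * d%:~R - b%:~R * c%:~R = 1 :> R by rewrite -!intrM -intrB det1.
(* Completing the square: AC - B^2 is the square of h (1 + alpha^2) det. *)
have key j i : (line_lead * i%:~R + B j) ^+ 2 <= line_disc L j =
   (((e (j, i)).1%:~R + alpha * (e (j, i)).2%:~R) ^+ 2 +
      h ^+ 2 * ((e (j, i)).2%:~R - alpha * (e (j, i)).1%:~R) ^+ 2 <= L).
  rewrite -[RHS](ler_pM2l lp) /line_disc lerBrDr /e /= !intrD !intrM; congr (_ <= _).
  have -> : h * (1 + alpha ^+ 2) * j%:~R =
      h * (1 + alpha ^+ 2) * j%:~R * (a%:~R * d%:~R - b%:~R * c%:~R) by rewrite detR mulr1.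
  by rewrite /B /line_lead /sw /tw /coordF /coordH; ring.
rewrite (@reindex_esum _ _ _ (J `*`` I) _ e); last first.
  split.
  - by move=> [j i] [/= _]; rewrite /I /= key.
  - move=> [j i] [j' i'] _ _ [e1 e2].
    have X : (i - i') * a + (j - j') * c = 0 by lia.
    have Y : (i - i') * b + (j - j') * d = 0 by lia.
    have : i - i' = ((i - i') * a + (j - j') * c) * d - ((i - i') * b + (j - j') * d) * c.
      by rewrite -[LHS]mulr1 -det1; ring.
    have : j - j' = ((i - i') * b + (j - j') * d) * a - ((i - i') * a + (j - j') * c) * b.
      by rewrite -[LHS]mulr1 -det1; ring.
    by rewrite X Y !mul0r subrr => H1 H2; congr pair; lia.
  - move=> [m n] /= H; exists (a * n - b * m, m * d - n * c).
      have E : e (a * n - b * m, m * d - n * c) = (m, n).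
        by rewrite /e /=; congr pair; rewrite -[RHS]mulr1 -det1; ring.
      have K : (line_lead * (m * d - n * c)%:~R + B (a * n - b * m)) ^+ 2 <= line_disc L (a * n - b * m).
        by rewrite key E.
      by split => //=; rewrite /J /=; apply: le_trans K; exact: sqr_ge0.
    by rewrite /e /=; congr pair; rewrite -[RHS]mulr1 -det1; ring.
rewrite -(@esum_esum _ _ _ J I (fun _ _ => 1%E))//.
pose n j : R := fine (\esum_(i in I j) 1%E).
have fJ : finite_set J by exact: finite_line_disc.
have nP j : J j -> (\esum_(i in I j) 1%E) = (n j)%:E /\ `|n j - 2 * Num.sqrt (line_disc L j) / line_lead| <= 1.
  move=> Jj; have [H1 H2] := count_int_square (B j) lp Jj.
  by split => //; rewrite /n fineK.
rewrite (eq_esum (b := fun j => (n j)%:E)); last by move=> j /nP[].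
rewrite esum_fset//; last first.
  by move=> j _; rewrite lee_fin; apply: fine_ge0; exact: esum_ge0.
exists (\sum_(j \in J) (n j - 2 * Num.sqrt (line_disc L j) / line_lead)).
  rewrite !fsbig_finite//= (le_trans (ler_norm_sum _ _ _))//.
  rewrite big_seq [leRHS]big_seq; apply: ler_sum => j.
  by rewrite [_ \in _](in_fset_set fJ) inE => /nP[].
rewrite !fsbig_finite//= sumEFin -big_split /=; congr EFin.
by apply: eq_bigr => j _; rewrite addrC subrK.
Qed.

End BasisCount.

(** * Rational slopes *)

Section Asymptotics.
Context {R : realType}.

Lemma littleo_inv (r : R -> R) :
  (forall e : R, 0 < e -> exists2 d : R, 0 < d & forall h, 0 < h < d -> `|r h| <= e * h^-1) ->
  r =o_ (0^'+) (fun h : R => h^-1).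
Proof.
move=> H; apply/eqoP => e e0; have [d d0 Hd] := H e e0.
near=> h.
have h0 : 0 < h by near: h; exact: nbhs_right_gt.
have hd : h < d by near: h; exact: nbhs_right_lt.
rewrite [X in _ <= _ * X]ger0_norm ?invr_ge0 ?(ltW h0)//; apply: Hd.
by rewrite h0 hd.
Unshelve. all: by end_near. Qed.

Lemma eigval_le (alpha h lambda : R) k : (eigval alpha h k <= lambda) =
  ((k.1%:~R + alpha * k.2%:~R) ^+ 2 + h ^+ 2 * (k.2%:~R - alpha * k.1%:~R) ^+ 2
    <= lambda * (1 + alpha ^+ 2) / (4 * pi ^+ 2)).
Proof.
have a0 : 0 < 1 + alpha ^+ 2 by rewrite ltr_pwDl// sqr_ge0.
have p0 : 0 < 4 * pi ^+ 2 :> R by rewrite mulr_gt0 ?exprn_gt0 ?pi_gt0.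
by rewrite ler_pdivlMr// /eigval mulrAC ler_pdivrMr// [X in X <= _]mulrC.
Qed.

Lemma N_basis (alpha h lambda : R) (a b c d : int) :
  0 < h <= 1 -> a * d - b * c = 1 ->
  let J := [set j : int | 0 <= line_disc alpha h a b (lambda * (1 + alpha ^+ 2) / (4 * pi ^+ 2)) j] in
  exists2 r : R, `|r| <= \sum_(j \in J) (1 : R) & N_ alpha h lambda =
  (\sum_(j \in J) 2 * Num.sqrt (line_disc alpha h a b (lambda * (1 + alpha ^+ 2) / (4 * pi ^+ 2)) j)
     / line_lead alpha h a b + r)%:E.
Proof.
move=> h01 det1 J; have /andP[h0 _] := h01.
have [r r1 rE] := lattice_count alpha h0 det1 (lambda * (1 + alpha ^+ 2) / (4 * pi ^+ 2)).
exists r => //; rewrite -[RHS]rE N_lattice//; congr esum.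
by apply/seteqP; split => k /=; rewrite eigval_le.
Qed.

(** The vector (p, - q) has no component along F, so that [line_lead] is a multiple
    of h^2 and the condition [0 <= line_disc] does not involve h. The lines where it is
    an equality have chord 0: they count for the error only. *)
Lemma rational_case (alpha lambda : R) (p q : int) :
    q != 0 -> coprimez p q -> alpha = p%:~R / q%:~R ->
    exists r : R -> R,
      (forall h : R, 0 < h <= 1 ->
        N_ alpha h lambda =
          (h^-1 *
             \sum_(k \in [set k : int |
                           4 * pi ^+ 2 / (p%:~R ^+ 2 + q%:~R ^+ 2)
                             * k%:~R ^+ 2 < lambda])
               (1 / (pi * Num.sqrt (p%:~R ^+ 2 + q%:~R ^+ 2)) *
                Num.sqrt (lambda - 4 * pi ^+ 2 / (p%:~R ^+ 2 + q%:~R ^+ 2)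
                                     * k%:~R ^+ 2))
           + r h)%:E) /\
      r =o_ (0^'+) (fun h : R => h^-1).
Proof.
move=> q0 cpq aE; have qR0 : q%:~R != 0 :> R by rewrite intr_eq0.
have /coprimezP[[d c] /= dc] := cpq.
have det1 : p * d - (- q) * c = 1 by rewrite -dc; ring.
set n2 : R := p%:~R ^+ 2 + q%:~R ^+ 2.
have n20 : 0 < n2 by rewrite ltr_wpDl ?sqr_ge0// exprn_even_gt0.
pose s := Num.sqrt n2; have s0 : 0 < s by rewrite sqrtr_gt0.
have sE : s ^+ 2 = n2 by rewrite sqr_sqrtr// ltW.
have p0 := @pi_gt0 R.
pose t (k : int) : R := 4 * pi ^+ 2 / n2 * k%:~R ^+ 2.
set main := \sum_(k \in _) _.
pose J := [set j : int | t j <= lambda].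
have leadE h : line_lead alpha h p (- q) = h ^+ 2 * n2 ^+ 2 / q%:~R ^+ 2.
  by rewrite /line_lead /coordF /coordH aE mulrNz /n2; field.
have discE h j : line_disc alpha h p (- q) (lambda * (1 + alpha ^+ 2) / (4 * pi ^+ 2)) j =
    (h * n2 * s / (2 * pi * q%:~R ^+ 2)) ^+ 2 * (lambda - t j).
  rewrite /line_disc leadE expr_div_n !exprMn sE /t aE.
  have := gt_eqF p0; move: (pi : R) => P /negbT P0.
  have -> : 1 + (p%:~R / q%:~R) ^+ 2 = n2 / q%:~R ^+ 2 by rewrite /n2; field.
  by field; rewrite qR0 P0 gt_eqF.
have wgt0 h : 0 < h -> 0 < h * n2 * s / (2 * pi * q%:~R ^+ 2).
  move=> h0; have q20 : 0 < q%:~R ^+ 2 :> R by rewrite exprn_even_gt0.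
  apply: divr_gt0; apply: mulr_gt0 => //; exact: mulr_gt0.
have JE h : 0 < h -> [set j : int | 0 <= line_disc alpha h p (- q) (lambda * (1 + alpha ^+ 2) / (4 * pi ^+ 2)) j] = J.
  move=> h0; have w0 := exprn_gt0 2 (wgt0 h h0).
  by apply/seteqP; split => j /=; rewrite discE /J /= (pmulr_rge0 _ w0) subr_ge0.
pose C : R := \sum_(j \in J) (1 : R).
have mainE h : 0 < h ->
   \sum_(j \in J) 2 * Num.sqrt (line_disc alpha h p (- q) (lambda * (1 + alpha ^+ 2) / (4 * pi ^+ 2)) j) /
    line_lead alpha h p (- q) = h^-1 * main.
  move=> h0; rewrite /main.
  rewrite -(@fsbig_widen _ _ _ _ [set k : int | t k < lambda] J); last first.
  (* These are the lines with chord 0. *)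
  - move=> j [/= j1 /negP]; rewrite -leNgt => j2.
    have tl : t j = lambda by apply/eqP; rewrite eq_le j1 j2.
    by rewrite discE tl subrr mulr0 sqrtr0 mulr0 mul0r.
  - by move=> j /ltW.
  rewrite -/s.
  have fin : finite_set [set k : int | t k < lambda].
    apply: (@sub_finite_set _ _ J) => [j /ltW//|].
    by rewrite -(JE _ h0); exact: finite_line_disc.
  rewrite !fsbig_finite//= mulr_sumr; apply: eq_bigr => j _.
  rewrite discE leadE sqrtrM ?sqr_ge0// sqrtr_sqr (gtr0_norm (wgt0 h h0)).
  rewrite -/(t j); move: (Num.sqrt (lambda - t j)) => x; rewrite -sE.
  have := gt_eqF p0; move: (pi : R) => P /negbT P0.
  by field; rewrite qR0 P0 !gt_eqF.
exists (fun h => fine (N_ alpha h lambda) - h^-1 * main); split.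
  move=> h h01; have /andP[h0 _] := h01.
  have [r _ ->] := N_basis alpha lambda h01 det1.
  by rewrite [fine _]/=; congr EFin; ring.
apply: littleo_inv => e e0; exists (Num.min 1 (e / (`|C| + 1))).
  by rewrite lt_min ltr01 divr_gt0// ltr_pwDr.
move=> h /andP[h0]; rewrite lt_min => /andP[h1 hC].
have h01 : 0 < h <= 1 by rewrite h0 ltW.
have [r r1 ->] := N_basis alpha lambda h01 det1.
move: r1; rewrite JE// [fine _]/= mainE// => r1.
rewrite [h^-1 * main + r]addrC addrK.
apply: (le_trans r1); apply: le_trans (ler_norm _) _; rewrite -/C.
rewrite ler_pdivlMr//; move: hC; rewrite ltr_pdivlMr ?ltr_pwDr// => hC.
have := normr_ge0 C; nra.
Qed.

End Asymptotics.

(** * Riemann sums for the half-disc *)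

Section HalfDisc.
Context {R : realType}.

Lemma cos_anti (u t : R) : 0 <= u -> u <= t -> t <= pi -> cos t <= cos u.
Proof.
move=> u0; rewrite le_eqVlt => /orP[/eqP->//|ut] tp; apply: ltW.
by rewrite ltr_cos// in_itv /=; apply/andP; split; lra.
Qed.

(** A primitive of sqrt (1 - x^2) in the coordinate x = sin t, where it is smooth up
    to the end point x = 1. *)
Definition sector (t : R) : R := (t + sin t * cos t) / 2.

Lemma is_derive_sector (c u : R) :
  is_derive u 1 (fun u => sector u - sin u * c) (cos u * (cos u - c)).
Proof.
have d1 := is_deriveM (is_derive_sin u) (is_derive_cos u).
have d2 := is_deriveZ 2^-1 (is_deriveD (is_derive_id u (1 : R)) d1).
have d3 := is_deriveB d2 (is_deriveZ c (is_derive_sin u)).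
rewrite (_ : (fun u => _) = (2^-1 \*: (id + sin * cos) - c \*: sin)); last first.
  apply/funext => x; rewrite -[RHS]/(2^-1 * (x + sin x * cos x) - c * sin x) /sector.
  by field.
move/is_derive_eq : d3; apply; rewrite /GRing.scale /=.
have := cos2Dsin2 u; nra.
Qed.

Lemma sector_bounds (s t : R) : 0 <= s -> s <= t -> t <= pi / 2 ->
  (sin t - sin s) * cos t <= sector t - sector s <= (sin t - sin s) * cos s.
Proof.
move=> s0 st tp; have p0 := @pi_gt0 R.
have H c : exists2 u, s <= u <= t &
    sector t - sector s - (sin t - sin s) * c = cos u * (cos u - c) * (t - s).
  have [||u uI E] := @MVT_segment R (fun u => sector u - sin u * c)
    (fun u => cos u * (cos u - c)) s t st.
  - by move=> x _; exact: is_derive_sector.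
  - apply: continuous_subspaceT => x; apply: differentiable_continuous.
    by apply/derivable1_diffP; have [] := is_derive_sector c x.
  - by exists u; rewrite -?E//; ring.
have C u : s <= u <= t -> [/\ 0 <= cos u, cos t <= cos u & cos u <= cos s].
  move=> /andP[su ut]; split.
  - by apply: cos_ge0_pihalf; apply/andP; split; lra.
  - by apply: cos_anti; lra.
  - by apply: cos_anti; lra.
apply/andP; split.
- have [u /C[c0 c1 c2] E] := H (cos t); rewrite -subr_ge0 E.
  by rewrite !mulr_ge0 ?subr_ge0.
- have [u /C[c0 c1 c2] E] := H (cos s); rewrite -subr_le0 E.
  by rewrite mulr_le0_ge0 ?subr_ge0// mulr_ge0_le0 ?subr_le0.
Qed.

Lemma asin_mono (x y : R) : 0 <= x -> x <= y -> y <= 1 ->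
  [/\ 0 <= asin x, asin x <= asin y & asin y <= pi / 2].
Proof.
move=> x0 xy y1; have p0 := @pi_gt0 R.
have Y : -1 <= y <= 1 by apply/andP; split; lra.
have X : -1 <= x <= 1 by apply/andP; split; lra.
have mono a b : -1 <= a <= 1 -> -1 <= b <= 1 -> a <= b -> asin a <= asin b.
  move=> A B ab; rewrite leNgt; apply/negP => lt.
  have : sin (asin b) < sin (asin a).
    by rewrite ltr_sin// in_itv /= ?asin_geNpi2 ?asin_lepi2.
  by rewrite !asinK ?in_itv//= ltNge ab.
split; [|exact: mono|exact: asin_lepi2].
rewrite -[leLHS](@sinK R); last by rewrite in_itv /=; apply/andP; split; lra.
by rewrite sin0; apply: mono => //; apply/andP; split; lra.
Qed.

Definition half_circle (x : R) : R := Num.sqrt (1 - x ^+ 2).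

Lemma half_circle_bounds (x y : R) : 0 <= x -> x <= y -> y <= 1 ->
  (y - x) * half_circle y <= sector (asin y) - sector (asin x) <= (y - x) * half_circle x.
Proof.
move=> x0 xy y1; have [s0 st tp] := asin_mono x0 xy y1.
have Y : -1 <= y <= 1 by apply/andP; split; lra.
have X : -1 <= x <= 1 by apply/andP; split; lra.
by have := sector_bounds s0 st tp; rewrite !asinK ?in_itv//= !cos_asin.
Qed.

Lemma sector_asin0 : sector (asin 0) = 0.
Proof.
have p0 := @pi_gt0 R.
rewrite -[X in asin X](@sin0 R) sinK ?in_itv /=; last by apply/andP; split; lra.
by rewrite /sector sin0 mul0r addr0 mul0r.
Qed.

Lemma sector_asin1 : sector (asin 1) = pi / 4.
Proof.
have p0 := @pi_gt0 R.
rewrite -[X in asin X](@sin_pihalf R) sinK ?in_itv /=; last by apply/andP; split; lra.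
by rewrite /sector cos_pihalf mulr0; field.
Qed.

(** Right-end values bound the integral of a decreasing function from below. Left-end
    values for i = 0, ..., n bound it from above, as the last step is shorter than
    kappa; passing from these to the right-end values drops the value 1 at i = 0 and
    costs kappa. *)
Lemma riemann_quarter (kappa : R) (n : nat) : 0 < kappa ->
  n%:R * kappa <= 1 -> 1 < n.+1%:R * kappa ->
  pi / 4 - kappa <= kappa * \sum_(i < n) half_circle (i.+1%:R * kappa) <= pi / 4.
Proof.
move=> k0 n1 n2; pose H x := sector (asin x).
have hb x y : 0 <= x -> x <= y -> y <= 1 ->
  (y - x) * half_circle y <= H y - H x <= (y - x) * half_circle x := @half_circle_bounds x y.
have le1 (i : nat) : (i <= n)%N -> i%:R * kappa <= 1.
  by move=> iN; apply: le_trans n1; rewrite ler_pM2r// ler_nat.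
have ge0 (i : nat) : 0 <= i%:R * kappa by rewrite mulr_ge0// ltW.
have step (i : nat) : i.+1%:R * kappa - i%:R * kappa = kappa by rewrite -natr1; ring.
have mon (i : nat) : i%:R * kappa <= i.+1%:R * kappa by rewrite ler_pM2r// ler_nat.
have tel : \sum_(i < n) (H (i.+1%:R * kappa) - H (i%:R * kappa)) = H (n%:R * kappa) - H 0.
  rewrite -(big_mkord xpredT (fun i => H (i.+1%:R * kappa) - H (i%:R * kappa))).
  by rewrite (telescope_sumr (fun i => H (i%:R * kappa)))// mul0r.
have H1 : H 1 = pi / 4 by exact: sector_asin1.
have H0 : H 0 = 0 by exact: sector_asin0.
have /andP[l1 l2] := hb _ _ (ge0 n) n1 (lexx 1).
have hc0 x : 0 <= half_circle x by exact: sqrtr_ge0.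
apply/andP; split.
- have A : H (n%:R * kappa) - H 0 <= kappa * \sum_(i < n) half_circle (i%:R * kappa).
    rewrite -tel mulr_sumr; apply: ler_sum => i _.
    have /andP[_] := hb _ _ (ge0 i) (mon i) (le1 _ (ltn_ord i)).
    by rewrite step.
  have B : kappa * \sum_(i < n) half_circle (i%:R * kappa) + kappa * half_circle (n%:R * kappa) =
      kappa + kappa * \sum_(i < n) half_circle (i.+1%:R * kappa).
    have Er : \sum_(i < n.+1) half_circle (i%:R * kappa) =
        \sum_(i < n) half_circle (i%:R * kappa) + half_circle (n%:R * kappa).
      by rewrite big_ord_recr.
    have El : \sum_(i < n.+1) half_circle (i%:R * kappa) =
        1 + \sum_(i < n) half_circle (i.+1%:R * kappa).
      rewrite big_ord_recl; congr (_ + _).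
      by rewrite /half_circle mul0r expr0n subr0 sqrtr1.
    by rewrite -mulrDr -Er El mulrDr mulr1.
  have C : (1 - n%:R * kappa) * half_circle (n%:R * kappa) <= kappa * half_circle (n%:R * kappa).
    by apply: ler_wpM2r => //; move: n2; rewrite -natr1; lra.
  move: A B C l2; rewrite H0 H1; lra.
- have A : kappa * \sum_(i < n) half_circle (i.+1%:R * kappa) <= H (n%:R * kappa) - H 0.
    rewrite -tel mulr_sumr; apply: ler_sum => i _.
    have /andP[+ _] := hb _ _ (ge0 i) (mon i) (le1 _ (ltn_ord i)).
    by rewrite step.
  have := hc0 1; have : 0 <= (1 - n%:R * kappa) * half_circle 1.
    by rewrite mulr_ge0 ?subr_ge0.
  move: A l1; rewrite H0 H1; lra.
Qed.

Lemma fsbig_symmetric (F : int -> R) (n : nat) : (forall j, F (- j) = F j) ->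
  \sum_(j \in [set j : int | (`|j| <= n)%N]) F j = F 0 + 2 * \sum_(i < n) F (i.+1)%:Z.
Proof.
move=> FN; rewrite (@reindex_fsbig _ _ _ _ _ (fun i : nat => i%:Z - n%:Z) `I_(n + n).+1); last first.
  split.
  - by move=> k /= kn; lia.
  - by move=> k l _ _ /=; lia.
  - by move=> j /= jn; exists (absz (j + n%:Z)) => /=; lia.
rewrite -(fsbig_ord _ (n + n).+1 (fun i : nat => F (i%:Z - n%:Z))).
elim: n => [|n ih]; first by rewrite !big_ord_recl !big_ord0 subr0 mulr0.
rewrite (_ : (n.+1 + n.+1).+1 = (n + n).+1.+2)%N; last by lia.
rewrite big_ord_recr big_ord_recl /= [in RHS]big_ord_recr /=.
rewrite (eq_bigr (fun i : 'I_(n + n).+1 => F (i%:Z - n%:Z))); last first.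
  by move=> i _; congr F; rewrite /bump /=; lia.
rewrite ih (_ : 0%:Z - n.+1%:Z = - (n.+1)%:Z); last by lia.
rewrite FN (_ : (n + n).+2%:Z - n.+1%:Z = n.+1%:Z); last by lia.
ring.
Qed.

Lemma riemann_half (kappa : R) : 0 < kappa ->
  let J := [set j : int | (kappa * j%:~R) ^+ 2 <= 1] in
  [/\ finite_set J, \sum_(j \in J) (1 : R) <= 2 / kappa + 1 &
    `|kappa * \sum_(j \in J) half_circle (kappa * j%:~R) - pi / 2| <= kappa].
Proof.
move=> k0 J; have ik0 : 0 < kappa^-1 by rewrite invr_gt0.
pose n := Num.truncn kappa^-1.
have /andP[n1 n2] := truncn_itv (ltW ik0); rewrite -/n in n1 n2.
have {}n1 : n%:R * kappa <= 1 by rewrite -ler_pdivlMr// div1r.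
have {}n2 : 1 < n.+1%:R * kappa by rewrite -ltr_pdivrMr// div1r.
have JE : J = [set j : int | (`|j| <= n)%N].
  have E (j : int) : (kappa * j%:~R) ^+ 2 = (kappa * `|j|%:R) ^+ 2.
    by rewrite !exprMn natr_absz intr_norm real_normK ?num_real.
  apply/seteqP; split => j; rewrite /J /= E => H.
    rewrite leqNgt; apply/negP => nj.
    have : 1 < kappa * `|j|%:R by rewrite mulrC (lt_le_trans n2)// ler_pM2r// ler_nat.
    by nra.
  have : kappa * `|j|%:R <= 1 by rewrite mulrC (le_trans _ n1)// ler_pM2r// ler_nat.
  have : 0 <= kappa * `|j|%:R by rewrite mulr_ge0// ltW.
  by nra.
have fJ : finite_set J.
  rewrite JE; apply: (sub_finite_set _ (finite_int_le (n%:R : R))) => j /= jn.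
  by rewrite -intr_norm -natr_absz ler_nat.
split=> //.
- rewrite JE fsbig_symmetric// sumr_const card_ord.
  have : n%:R <= kappa^-1 by rewrite -div1r ler_pdivlMr.
  by rewrite -[1 *+ n]/(n%:R : R); lra.
- rewrite JE fsbig_symmetric; last by move=> j; rewrite /half_circle mulrNz mulrN sqrrN.
  have /andP[] := riemann_quarter k0 n1 n2.
  rewrite (eq_bigr (fun i : 'I_n => half_circle (kappa * i.+1%:R))); last first.
    by move=> i _; rewrite mulrC.
  rewrite [half_circle (kappa * 0%:~R)](_ : _ = 1); last first.
    by rewrite /half_circle mulr0 expr0n subr0 sqrtr1.
  set T := \sum_(i < n) _; rewrite ler_norml => A B; apply/andP; split; nra.
Qed.

End HalfDisc.

(** * Irrational slopes *)

Section Irrational.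
Context {R : realType}.
Implicit Types (alpha : R).

Lemma irrational_comb_neq0 alpha (a b : int) : irrational alpha -> b != 0 ->
  a%:~R + alpha * b%:~R != 0.
Proof.
move=> irr b0; apply/eqP => ab; apply: irr.
have bR : b%:~R != 0 :> R by rewrite intr_eq0.
exists ((- a)%:~R / b%:~R) => //.
rewrite fmorph_div /= !ratr_int mulrNz.
by apply: (mulIf bR); rewrite mulfVK//; move: ab; lra.
Qed.

(** One step of the Euclidean algorithm on 1 and x = a + alpha b: the remainder
    of 1 by x, or its complement to x, is at most x / 2. *)
Lemma small_comb alpha (n : nat) : irrational alpha ->
  exists a b : int, b != 0 /\ 0 < a%:~R + alpha * b%:~R <= 2 ^- n.
Proof.
move=> irr; elim: n => [|n [a [b [b0 /andP[x0 xn]]]]].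
  exists (- Num.floor alpha), 1; split => //; rewrite expr0 invr1 mulr1.
  have := floor_itv alpha; rewrite intrD => /andP[f1 f2].
  have := @irrational_comb_neq0 alpha (- Num.floor alpha) 1 irr isT.
  rewrite mulr1 mulrNz => N0; apply/andP; split; last by lra.
  by rewrite lt_neqAle eq_sym N0 /=; lra.
set x := _ + _ in x0 xn.
have [k [k0 k1 k2]] : exists k : int, [/\ 0 < k, k%:~R * x <= 1 & 1 < (k + 1)%:~R * x].
  exists (Num.floor x^-1); have /andP[f1 f2] := floor_itv x^-1; split.
  - have : x <= 1 by apply: le_trans xn _; rewrite invf_le1 ?exprn_gt0// exprn_ege1// ler1n.
    move=> x1; by rewrite gtz0_ge1 floor_ge_int_tmp invf_ge1.
  - by rewrite -ler_pdivlMr// div1r.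
  - by rewrite -ltr_pdivrMr// div1r.
have E : 2 ^- n.+1 = 2 ^- n / 2 :> R by rewrite exprS invfM mulrC.
rewrite E intrD in k2 *.
have [r2|r2] := leP (1 - k%:~R * x) (x / 2).
  exists (1 - k * a), (- k * b).
  have b'0 : - k * b != 0 by rewrite mulf_neq0// oppr_eq0 gt_eqF.
  split => //; have := irrational_comb_neq0 (1 - k * a) irr b'0.
  have -> : (1 - k * a)%:~R + alpha * (- k * b)%:~R = 1 - k%:~R * x.
    by rewrite /x intrB !intrM mulrNz; ring.
  move=> N0; rewrite lt_neqAle eq_sym N0 subr_ge0 k1/=; lra.
exists ((k + 1) * a - 1), ((k + 1) * b).
have b'0 : (k + 1) * b != 0 by rewrite mulf_neq0// gt_eqF// addr_gt0.
split => //; have := irrational_comb_neq0 ((k + 1) * a - 1) irr b'0.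
have -> : ((k + 1) * a - 1)%:~R + alpha * ((k + 1) * b)%:~R = (k%:~R + 1%:~R) * x - 1.
  by rewrite /x intrB !intrM intrD; ring.
move=> N0; apply/andP; split; last by lra.
by rewrite lt_neqAle eq_sym N0 /=; lra.
Qed.

(** Dividing by the gcd keeps the combination small; primitive vectors extend to
    bases of Z^2. *)
Lemma small_basis alpha (e : R) : irrational alpha -> 0 < e ->
  exists a b c d : int, a * d - b * c = 1 /\ 0 < coordF alpha a b <= e.
Proof.
move=> irr e0.
have [n ne] : exists n : nat, 2 ^- n <= e.
  exists (Num.truncn e^-1).+1.
  have := truncnS_gt e^-1; set N := (Num.truncn _).+1 => H.
  rewrite -[e]invrK lef_pV2 ?posrE ?exprn_gt0 ?invr_gt0//.
  apply: (le_trans (ltW H)); rewrite -natrX ler_nat; apply: ltnW; exact: ltn_expl.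
have [a [b [b0 /andP[x0 xn]]]] := small_comb n irr.
have [u [v uv]] := Bezoutz a b.
pose g := gcdz a b.
have gn0 : g != 0 by rewrite gcdz_eq0 negb_and b0 orbT.
have g0 : 0 < g by rewrite lt_def gn0 /g /gcdz.
have [a' a'E] : exists a', a = a' * g by apply/dvdzP; exact: dvdz_gcdl.
have [b' b'E] : exists b', b = b' * g by apply/dvdzP; exact: dvdz_gcdr.
have svE : a%:~R + alpha * b%:~R = coordF alpha a' b' * g%:~R.
  by rewrite a'E b'E /coordF !intrM; ring.
have gR : 1 <= g%:~R :> R by rewrite -[1]/(1%:~R) ler_int -gtz0_ge1.
have sv0 : 0 < coordF alpha a' b' by move: x0; rewrite svE pmulr_lgt0//; lra.
exists a', b', (- v), u; split.
  apply: (mulIf gn0); rewrite mul1r; transitivity (u * a + v * b); last exact: uv.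
  by rewrite [in RHS]a'E [in RHS]b'E; ring.
rewrite sv0 /= (le_trans _ (le_trans xn ne))// svE.
by rewrite ler_peMr// ltW.
Qed.

Lemma line_lead_bounds alpha (h : R) (a b : int) : 0 < h -> 0 < coordF alpha a b ->
  coordF alpha a b <= Num.sqrt (line_lead alpha h a b) <= coordF alpha a b + h * `|coordH alpha a b|.
Proof.
move=> h0 d0; have t0 := normr_ge0 (coordH alpha a b).
have hT : 0 <= h * `|coordH alpha a b| by rewrite mulr_ge0// ltW.
have E : line_lead alpha h a b = coordF alpha a b ^+ 2 + (h * `|coordH alpha a b|) ^+ 2.
  by rewrite /line_lead exprMn real_normK ?num_real.
have d1 := ltW d0; rewrite E; apply/andP; split.
  by rewrite -{1}(ger0_norm d1) -sqrtr_sqr ler_wsqrtr// lerDl sqr_ge0.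
rewrite -[leRHS](ger0_norm (addr_ge0 d1 hT)) -[leRHS]sqrtr_sqr ler_wsqrtr//.
by have := mulr_ge0 d1 hT; nra.
Qed.

(** The error consists of the number of lines meeting the ellipse and of the
    error of the Riemann sum; only the first depends on h, with a factor
    [coordF alpha a b] in front of 1 / h. *)
Lemma N_estimate (alpha lambda h s : R) (a b c d : int) :
  0 <= lambda -> 0 < h <= 1 -> a * d - b * c = 1 -> 0 < coordF alpha a b ->
  s = Num.sqrt (lambda * (1 + alpha ^+ 2) / (4 * pi ^+ 2)) ->
  `|fine (N_ alpha h lambda) - 1 / (4 * pi) * h^-1 * lambda| <=
  2 * s * coordF alpha a b / h + (2 * s * `|coordH alpha a b| + 1 + 2 * s / coordF alpha a b).
Proof.
move=> lam0 h01 det1 d0 sdef; have /andP[h0 h1] := h01; have p0 := @pi_gt0 R.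
have al1 : 1 <= 1 + alpha ^+ 2 by rewrite lerDl sqr_ge0.
have al0 : 0 < 1 + alpha ^+ 2 by lra.
have pi4 : 0 < 4 * pi ^+ 2 :> R by rewrite mulr_gt0// exprn_gt0.
have [r] := N_basis alpha lambda h01 det1.
set L := lambda * _ / _ in sdef *.
have L0 : 0 <= L by apply: divr_ge0 (ltW pi4); exact: mulr_ge0 (ltW al0).
have s0 : 0 <= s by rewrite sdef sqrtr_ge0.
have sE : s ^+ 2 = L by rewrite sdef sqr_sqrtr.
set dl := coordF alpha a b in d0 *; set T := `|coordH alpha a b|.
have T0 : 0 <= T by exact: normr_ge0.
have d1 := ltW d0; have h2 := ltW h0.
have err0 : 0 <= 2 * s * dl / h by rewrite divr_ge0 ?mulr_ge0.
have err1 : 0 <= 2 * s * T by rewrite !mulr_ge0.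
have err2 : 0 <= 2 * s / dl by rewrite divr_ge0 ?mulr_ge0.
(* For lambda = 0 the ellipse is a point, and the step of the Riemann sum below
   would be infinite. *)
have [lz|lnz] := eqVneq lambda 0.
  have Lz : L = 0 by rewrite /L lz mul0r mul0r.
  set J := [set j | _]; have JE : J = [set 0].
    apply/seteqP; split => j; rewrite /J /= /line_disc Lz mulr0 sub0r oppr_ge0.
      move=> H; have /eqP : (h * (1 + alpha ^+ 2) * j%:~R) ^+ 2 = 0.
        by apply/eqP; rewrite eq_le H sqr_ge0.
      by rewrite sqrf_eq0 mulf_eq0 gt_eqF ?mulr_gt0//= intr_eq0 => /eqP.
    by move=> ->; rewrite mulr0 expr0n.
  rewrite JE !fsbig_set1 /line_disc Lz mulr0 mulr0 expr0n subr0 sqrtr0 mulr0 mul0r add0r.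
  by move=> r1 ->; rewrite lz mulr0 subr0 /=; lra.
have lp : 0 < lambda by rewrite lt_neqAle eq_sym lnz.
have sp : 0 < s by rewrite sdef sqrtr_gt0 divr_gt0 ?mulr_gt0.
pose l := Num.sqrt (line_lead alpha h a b).
have /andP[l1 l2] := line_lead_bounds h0 d0; rewrite -/l -/dl -/T in l1 l2.
have l0 : 0 < l by exact: lt_le_trans l1.
have lE : l ^+ 2 = line_lead alpha h a b by rewrite sqr_sqrtr// ltW// (line_lead_gt0 alpha h0 det1).
pose kappa := h * (1 + alpha ^+ 2) / (l * s).
have k0 : 0 < kappa by rewrite divr_gt0 ?mulr_gt0.
have discE j : line_disc alpha h a b L j = (l * s) ^+ 2 * (1 - (kappa * j%:~R) ^+ 2).
  by rewrite /line_disc -lE -sE /kappa; field; rewrite !gt_eqF.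
have [fJ cJ RS] := riemann_half k0.
rewrite (_ : [set j | 0 <= _] = [set j : int | (kappa * j%:~R) ^+ 2 <= 1]); last first.
  have w0 : 0 < (l * s) ^+ 2 by rewrite exprn_gt0// mulr_gt0.
  by apply/seteqP; split => j /=; rewrite discE (pmulr_rge0 _ w0) subr_ge0.
set J := [set j : int | _] in fJ cJ RS *.
have -> : \sum_(j \in J) 2 * Num.sqrt (line_disc alpha h a b L j) / line_lead alpha h a b =
    2 * s / l * \sum_(j \in J) half_circle (kappa * j%:~R).
  rewrite !fsbig_finite//= mulr_sumr; apply: eq_bigr => j _.
  rewrite discE sqrtrM ?sqr_ge0// sqrtr_sqr gtr0_norm ?mulr_gt0// -lE /half_circle.
  by field; rewrite gt_eqF.
set X := \sum_(j \in J) half_circle _ in RS *; move=> r1 -> /=.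
have mainE : 1 / (4 * pi) * h^-1 * lambda = 2 * s / l / kappa * (pi / 2).
  have -> : 2 * s / l / kappa = 2 * s ^+ 2 / (h * (1 + alpha ^+ 2)).
    by rewrite /kappa; field; rewrite !gt_eqF.
  rewrite sE /L; have := gt_eqF p0; move: (pi : R) => P /negbT P0.
  by field; rewrite P0 !gt_eqF.
have A : `|2 * s / l * X - 2 * s / l / kappa * (pi / 2)| <= 2 * s / dl.
  have -> : 2 * s / l * X - 2 * s / l / kappa * (pi / 2) = 2 * s / l / kappa * (kappa * X - pi / 2).
    have F (x k y z : R) : k != 0 -> x * y - x / k * z = x / k * (k * y - z).
      by move=> kn; field.
    by apply: F; rewrite gt_eqF.
  have q0 : 0 <= 2 * s / l / kappa 
    by apply: divr_ge0 (ltW k0); apply: divr_ge0 (ltW l0); exact: mulr_ge0.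
  rewrite normrM (ger0_norm q0) (le_trans (ler_wpM2l q0 RS))//.
  rewrite divfK ?gt_eqF// ler_wpM2l ?mulr_ge0// lef_pV2 ?posrE//.
have B : 2 / kappa <= 2 * s * dl / h + 2 * s * T.
  have -> : 2 / kappa = 2 * s / h * (l / (1 + alpha ^+ 2)).
    by rewrite /kappa; field; rewrite !gt_eqF.
  have -> : 2 * s * dl / h + 2 * s * T = 2 * s / h * (dl + h * T).
    by field; rewrite gt_eqF.
  apply: ler_wpM2l; first by rewrite divr_ge0 ?mulr_ge0.
  by apply: le_trans l2; rewrite ler_pdivrMr// ler_peMr// ltW.
rewrite mainE [X in `|X|](_ : _ = (2 * s / l * X - 2 * s / l / kappa * (pi / 2)) + r); last by ring.
apply: (le_trans (ler_normD _ _)); lra.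
Qed.

(** The vector of [small_basis] is chosen before h, so that its component along F takes
    half of e / h and the rest of the error the other half once h is small. *)
Lemma irrational_case (alpha lambda : R) : 0 <= lambda -> irrational alpha ->
    exists r : R -> R,
      (forall h : R, 0 < h <= 1 ->
        N_ alpha h lambda = (1 / (4 * pi) * h^-1 * lambda + r h)%:E) /\
      r =o_ (0^'+) (fun h : R => h^-1).
Proof.
move=> lam0 irr.
exists (fun h => fine (N_ alpha h lambda) - 1 / (4 * pi) * h^-1 * lambda); split.
  move=> h h01; have [a [b [c [d [det1 _]]]]] := small_basis irr ltr01.
  have [r _ ->] := N_basis alpha lambda h01 det1.
  by rewrite [fine _]/=; congr EFin; ring.
apply: littleo_inv => e e0.
pose s := Num.sqrt (lambda * (1 + alpha ^+ 2) / (4 * pi ^+ 2)).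
have s0 : 0 <= s by exact: sqrtr_ge0.
have e4 : 0 < e / (4 * (s + 1)) by rewrite divr_gt0// mulr_gt0// ltr_pwDr.
have [a [b [c [d [det1 /andP[d0 de]]]]]] := small_basis irr e4.
pose C := 2 * s * `|coordH alpha a b| + 1 + 2 * s / coordF alpha a b.
have C0 : 0 < C.
  by rewrite ltr_wpDr ?divr_ge0 ?mulr_ge0 ?(ltW d0)// ltr_wpDl// !mulr_ge0.
exists (Num.min 1 (e / (2 * C))).
  by rewrite lt_min ltr01 divr_gt0// mulr_gt0.
move=> h /andP[h0]; rewrite lt_min => /andP[h1 hC].
have h01 : 0 < h <= 1 by rewrite h0 ltW.
apply: le_trans (N_estimate lam0 h01 det1 d0 (erefl s)) _; rewrite -/C.
have i0 : 0 < h^-1 by rewrite invr_gt0.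
have A : 2 * s * coordF alpha a b <= e / 2.
  have : coordF alpha a b * (4 * (s + 1)) <= e by rewrite -ler_pdivlMr// mulr_gt0// ltr_pwDr.
  by nra.
have B : C <= e / 2 * h^-1.
  rewrite ler_pdivlMr//; move: hC; rewrite ltr_pdivlMr ?mulr_gt0//; lra.
have -> : e * h^-1 = e / 2 * h^-1 + e / 2 * h^-1 by field; rewrite gt_eqF.
apply: lerD => //.
by rewrite ler_pM2r.
Qed.

End Irrational.

(** * The asymptotic formulas *)

Theorem theorem1 (R : realType) (alpha : R) :
  (forall (h : R) (u : R * R -> R) (z : R * R),
      0 < h <= 1 -> smooth_torus u ->
      laplace_beltrami (g_ alpha h) u z =
        - (1 / (1 + alpha ^+ 2) *
             vfield (1, alpha) (vfield (1, alpha) u) z)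
        - h ^+ 2 / (1 + alpha ^+ 2) *
             vfield (- alpha, 1) (vfield (- alpha, 1) u) z) /\
  (forall lambda : R, 0 <= lambda -> irrational alpha ->
    exists r : R -> R,
      (forall h : R, 0 < h <= 1 ->
        N_ alpha h lambda = (1 / (4 * pi) * h^-1 * lambda + r h)%:E) /\
      r =o_ (0^'+) (fun h : R => h^-1)) /\
  (forall (lambda : R) (p q : int),
    q != 0 -> coprimez p q -> alpha = p%:~R / q%:~R ->
    exists r : R -> R,
      (forall h : R, 0 < h <= 1 ->
        N_ alpha h lambda =
          (h^-1 *
             \sum_(k \in [set k : int |
                           4 * pi ^+ 2 / (p%:~R ^+ 2 + q%:~R ^+ 2)
                             * k%:~R ^+ 2 < lambda])
               (1 / (pi * Num.sqrt (p%:~R ^+ 2 + q%:~R ^+ 2)) *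
                Num.sqrt (lambda - 4 * pi ^+ 2 / (p%:~R ^+ 2 + q%:~R ^+ 2)
                                     * k%:~R ^+ 2))
           + r h)%:E) /\
      r =o_ (0^'+) (fun h : R => h^-1)).
Proof.
split; first by move=> h u z /andP[h0 _]; exact: laplace_beltrami_vfield.
split; first by move=> lambda; exact: irrational_case.
by move=> lambda p q; exact: rational_case.
Qed.
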